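(* An ABC voting rule $f$ (for fixed $m\ge 2$ and fixed committee size $k\in\{1,\dots,m-1\}$) is a Thiele rule if and only if it satisfies anonymity, neutrality, consistency, continuity, and independence of losers.
   Context: Let $\mathcal C=\{c_1,\dots,c_m\}$ be a set of $m\ge 2$ candidates and $\mathbb N=\{1,2,\dots\}$ the set of potential voters. An electorate is a non-empty finite $N\subseteq\mathbb N$. An approval ballot is a non-empty subset of $\mathcal C$; $\mathcal A$ is the set of all ballots. A profile is a map $A:N\to\mathcal A$ for some electorate $N=N_A$, with $A_i$ the ballot of voter $i$; $\mathcal A^*$ is the set of all profiles. Profiles $A,A'$ are disjoint if $N_A\cap N_{A'}=\emptyset$, and then $A+A'$ is the profile on $N_A\cup N_{A'}$ agreeing with $A$ on $N_A$ and with $A'$ on $N_{A'}$. For $\lambda\in\mathbb N$, $\lambda A$ denotes a profile consisting of $\lambda$ copies of $A$ on pairwise disjoint voter sets. Fix $k\in\{1,\dots,m-1\}$; $\mathcal W_k=\{W\subseteq\mathcal C:|W|=k\}$ is the set of committees. An ABC voting rule is a map $f:\mathcal A^*\to 2^{\mathcal W_k}\setminus\{\emptyset\}$. Axioms: $f$ is anonymous if $f(A)=f(\pi(A))$ for all $A$ and permutations $\pi$ of $\mathbb N$, where $\pi(A)$ has electorate $\pi(N_A)$ and $\pi(A)_{\pi(i)}=A_i$. $f$ is neutral if $f(\tau(A))=\{\tau(W):W\in f(A)\}$ for all $A$ and permutations $\tau$ of $\mathcal C$, where $\tau(A)_i=\tau(A_i)$. $f$ is consistent if $f(A+A')=f(A)\cap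 f(A')$ for all disjoint $A,A'$ with $f(A)\cap f(A')\neq\emptyset$. $f$ is continuous if for all profiles $A,A'$ there is $\lambda\in\mathbb N$ with $f(\lambda A+A')\subseteq f(A)$. $f$ is independent of losers if $W\in f(A)$ implies $W\in f(A')$ for all profiles $A,A'$ with $N_A=N_{A'}$ and committees $W$ such that $A'_i\subseteq A_i$ and $W\cap A'_i=W\cap A_i$ for all $i\in N_A$. A Thiele scoring function is a non-decreasing $s:\{0,\dots,k\}\to\mathbb R$ with $s(0)=0$. $f$ is a Thiele rule if there is a Thiele scoring function $s$ with $f(A)=\{W\in\mathcal W_k:\hat s(A,W)\ge\hat s(A,W')\ \forall W'\in\mathcal W_k\}$ for all $A$, where $\hat s(A,W)=\sum_{i\in N_A}s(|A_i\cap W|)$. *)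

(* Defs.v *)
From HB Require Import structures.
From mathcomp Require Import all_boot all_order all_algebra all_fingroup.
From mathcomp Require Import finmap.
From mathcomp Require Import reals.
Set Implicit Arguments. Unset Strict Implicit. Unset Printing Implicit Defensive.
Import Order.TTheory GRing.Theory Num.Theory.
Local Open Scope fset_scope.
Local Open Scope fmap_scope.

(* Candidates: 'I_m.  Voters: nat.  A ballot is a {set 'I_m}.
   A profile is a finite map from voters (nat) to ballots whose domain
   (the electorate) is nonempty and whose values are nonempty ballots. *)
Definition ballots (m : nat) := {fmap nat -> {set 'I_m}}.

Definition is_profile m (A : ballots m) : bool :=
  (domf A != fset0) && [forall x : domf A, A x != set0].

Definition is_ABC_rule m k (f : ballots m -> {set {set 'I_m}}) : Prop :=
  forall A, is_profile A ->
    f A != set0 /\ (forall W, W \in f A -> #|W| = k).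

Definition relabel m (pi : nat -> nat) (A B : ballots m) : Prop :=
  domf B = [fset pi i | i in domf A] /\
  forall i, i \in domf A -> B.[? pi i] = A.[? i].

Definition anonymous m (f : ballots m -> {set {set 'I_m}}) : Prop :=
  forall (pi : nat -> nat) (A B : ballots m),
    bijective pi -> is_profile A -> relabel pi A B -> f B = f A.

Definition cand_perm m (tau : {perm 'I_m}) (A : ballots m) : ballots m :=
  [fmap x : domf A => imset tau (mem (A x))].

Definition neutral m (f : ballots m -> {set {set 'I_m}}) : Prop :=
  forall (tau : {perm 'I_m}) (A : ballots m), is_profile A ->
    f (cand_perm tau A) = imset (fun W : {set 'I_m} => imset tau (mem W)) (mem (f A)).

Definition disjoint_prof m (A A' : ballots m) : bool :=
  domf A `&` domf A' == fset0.

(* A + A' is finmap concatenation (catf); for disjoint profiles it agrees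
   with A on N_A and with A' on N_A'. *)
Definition consistent m (f : ballots m -> {set {set 'I_m}}) : Prop :=
  forall A A' : ballots m, is_profile A -> is_profile A' ->
    disjoint_prof A A' -> f A :&: f A' != set0 ->
    f (A + A') = f A :&: f A'.

(* B consists of l copies of A on pairwise disjoint voter sets:
   copy j of voter i is voter g j i, g injective on [0,l) x N_A. *)
Definition copies m (l : nat) (A B : ballots m) : Prop :=
  exists g : nat -> nat -> nat,
    (forall j1 j2 i1 i2, (j1 < l)%N -> (j2 < l)%N ->
        i1 \in domf A -> i2 \in domf A -> g j1 i1 = g j2 i2 ->
        j1 = j2 /\ i1 = i2) /\
    (forall v, v \in domf B <->
        exists j i, (j < l)%N /\ i \in domf A /\ v = g j i) /\
    (forall j i, (j < l)%N -> i \in domf A -> B.[? g j i] = A.[? i]).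

Definition continuous m (f : ballots m -> {set {set 'I_m}}) : Prop :=
  forall A A' : ballots m, is_profile A -> is_profile A' ->
    exists l : nat, (0 < l)%N /\
      forall B : ballots m, copies l A B -> disjoint_prof B A' ->
        f (B + A') \subset f A.

Definition indep_losers m (f : ballots m -> {set {set 'I_m}}) : Prop :=
  forall (A A' : ballots m) (W : {set 'I_m}),
    is_profile A -> is_profile A' -> domf A = domf A' ->
    (forall i, i \in domf A -> forall (X X' : {set 'I_m}),
        A.[? i] = Some X -> A'.[? i] = Some X' ->
        X' \subset X /\ W :&: X' = W :&: X) ->
    W \in f A -> W \in f A'.

Local Open Scope ring_scope.

Definition thiele_score (R : realType) m (s : nat -> R) (A : ballots m)
    (W : {set 'I_m}) : R :=
  \sum_(x : domf A) s #|A x :&: W|.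

(* Thiele scoring function on {0..k}: s 0 = 0, non-decreasing on {0..k}
   (values of s outside {0..k} are never used). *)
Definition is_thiele_scoring (R : realType) (k : nat) (s : nat -> R) : Prop :=
  s 0%N = 0 /\ (forall i j, (i <= j <= k)%N -> s i <= s j).

Definition is_thiele_rule (R : realType) m k
    (f : ballots m -> {set {set 'I_m}}) : Prop :=
  exists s : nat -> R, is_thiele_scoring k s /\
    forall A : ballots m, is_profile A ->
      f A = [set W : {set 'I_m} | (#|W| == k) &&
               [forall W' : {set 'I_m}, (#|W'| == k) ==>
                  (thiele_score s A W' <= thiele_score s A W)]].

(* Main.v *)
Require Import Defs.
From HB Require Import structures.
From mathcomp Require Import all_boot all_order all_algebra all_fingroup.
From mathcomp Require Import finmap.
From mathcomp Require Import reals.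
From mathcomp Require Import primitive_action alt boolp zify lra.
From mathcomp Require classical_sets.
Set Implicit Arguments. Unset Strict Implicit. Unset Printing Implicit Defensive.
Import Order.TTheory GRing.Theory Num.Theory.

(** A rule satisfying the axioms depends only on how often each ballot is cast,
    and since all committees win at the profile in which every ballot is cast
    once, it extends to signed ballot counts. For adjacent committees [a |: Z]
    and [b |: Z], independence of losers and averaging over the permutations
    fixing [a], [b] and [Z] show that their comparison depends only on the
    vector whose [l]-th entry is the number of ballots [X] with
    [#|X :&: Z| = l] that contain [a] but not [b], minus the number of those
    that contain [b] but not [a]. The vectors for which [a |: Z] may win form
    a cone, on which there is a nonzero positive functional; the partial sums
    of its coefficients are the scoring function [s].

    That winners score at least as much as the committees at distance [t] from
    them is shown by induction on [t]. If [s] is linear this is a pairing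
    argument. Otherwise let [j] be least with [s j <> j * s 1]: suitable signed
    counts then realise every function [V |-> \sum_(D \subset V, #|D| = j) g D],
    up to a positive factor, as a score. One such function is maximised exactly
    by the committees between two given ones, another one vanishes at these two
    and is positive strictly between them. Perturbing a counterexample by them
    contradicts consistency.

    So every winner maximises the score, and continuity gives the converse. *)

Lemma ler_norm_sum (R : numDomainType) (I : finType) (phi : I -> R) i :
  (`|phi i| <= \sum_l `|phi l|)%R.
Proof. by rewrite (bigD1 i) //= lerDl sumr_ge0. Qed.

Lemma eventually_lt_mulrn (R : archiRealFieldType) (a c : R) : (0 < c)%R ->
  exists n0, forall n, (n0 <= n)%N -> (a < c *+ n)%R.
Proof.
move=> c0; exists (Num.bound (`|a| / c)%R) => n n0n.
rewrite -mulr_natl -ltr_pdivrMr //.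
apply: (@le_lt_trans _ _ (`|a| / c)%R).
  by rewrite ler_pM2r ?invr_gt0 ?ler_norm.
apply: lt_le_trans (archi_boundP _) _; last by rewrite ler_nat.
by rewrite divr_ge0 // ltW.
Qed.

(* Take the least [t] at which some [f i + q i *+ t] exceeds [c]; one step
   earlier all of them are still at most [c]. *)
Lemma first_overtaking (R : archiRealFieldType) (I : finType) (P : pred I)
    (f q : I -> R) (c d : R) (i0 : I) :
  P i0 -> (forall i, P i -> f i <= c)%R -> (forall i, P i -> 0 < q i)%R ->
  (forall i, P i -> c + q i < d)%R ->
  exists t, (exists2 i, P i & c < f i + q i *+ t.+1)%R /\
    (forall i, P i -> f i + q i *+ t.+1 < d)%R.
Proof.
move=> Pi0 fc q0 cd.
pose overtaken t := [exists i, P i && (c < f i + q i *+ t)%R].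
have some_t : exists t, overtaken t.
  have [t far] := eventually_lt_mulrn (c - f i0) (q0 _ Pi0).
  by exists t; apply/existsP; exists i0; rewrite Pi0 -ltrBlDl far.
case: (ex_minnP some_t) => [[|t]] /existsP[i /andP[Pi ci]] tmin.
  by rewrite mulr0n addr0 ltNge fc in ci.
exists t; split=> [|l Pl]; first by exists i.
rewrite mulrSr addrA; apply: le_lt_trans (cd l Pl); rewrite lerD2r leNgt.
apply/negP => cl; suff /tmin : overtaken t by rewrite ltnn.
by apply/existsP; exists l; rewrite Pl.
Qed.

(** * Free abelian groups on finite types *)

Section FreeAbelianGroup.
Local Open Scope ring_scope.
Variable T : finType.
Implicit Types (x y : T) (v : {ffun T -> int}) (l : seq T).

Definition single x : {ffun T -> int} := [ffun y => (y == x)%:Z].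

Lemma sum_singleE l y : (\sum_(x <- l) single x) y = (count_mem y l)%:Z.
Proof.
elim: l => [|x l IH]; first by rewrite big_nil ffunE.
by rewrite big_cons ffunE IH ffunE /= PoszD eq_sym.
Qed.

Lemma sum_single_perm l l' :
  \sum_(x <- l) single x = \sum_(x <- l') single x -> perm_eq l l'.
Proof.
move/ffunP => e; apply/allP => x _ /=.
by apply/eqP; have := e x; rewrite !sum_singleE => -[].
Qed.

Definition linext (V : zmodType) (phi : T -> V) v : V := \sum_x phi x *~ v x.

Fact linext_is_zmod_morphism (V : zmodType) (phi : T -> V) :
  zmod_morphism (linext phi).
Proof.
by move=> v w; rewrite -sumrB; apply: eq_bigr => x _; rewrite !ffunE mulrzBr.
Qed.

HB.instance Definition _ (V : zmodType) (phi : T -> V) :=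
  GRing.isZmodMorphism.Build {ffun T -> int} V (linext phi)
    (linext_is_zmod_morphism phi).

Lemma linext_single (V : zmodType) (phi : T -> V) x :
  linext phi (single x) = phi x.
Proof.
rewrite /linext (bigD1 x) //= ffunE eqxx mulr1z big1 ?addr0 // => y yx.
by rewrite ffunE (negbTE yx) mulr0z.
Qed.

Lemma singleMz x (z : int) y : (single x *~ z) y = (y == x)%:Z * z.
Proof.
case: z => n; rewrite ?NegzE ?mulrNz -pmulrn ?ffunE ffunMnE ffunE ?mulrN.
  by rewrite -mulr_natr natz.
by rewrite -mulr_natr natz.
Qed.

Lemma linext_id v : linext single v = v.
Proof.
apply/ffunP => y; rewrite sum_ffunE (bigD1 y) //= singleMz eqxx mul1r.
by rewrite big1 ?addr0 // => x xy; rewrite singleMz eq_sym (negbTE xy) mul0r.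
Qed.

Lemma additive_linext (V : zmodType) (f : {additive {ffun T -> int} -> V}) v :
  f v = linext (fun x => f (single x)) v.
Proof.
by rewrite -{1}[v]linext_id raddf_sum; apply: eq_bigr => x _; rewrite raddfMz.
Qed.

Lemma eq_additive (V : zmodType) (f g : {additive {ffun T -> int} -> V}) :
  f \o single =1 g \o single -> f =1 g.
Proof.
move=> fg v; rewrite (additive_linext f) (additive_linext g).
by apply: eq_bigr => x _; have /= -> := fg x.
Qed.

End FreeAbelianGroup.
Arguments single {T} x.

(** * Positive functionals on abelian groups *)

Section PositiveFunctional.
Local Open Scope ring_scope.
Variables (R : realType) (G : zmodType) (u : G).
Implicit Types (A K : G -> Prop) (x y : G).

Definition add_closed A := A 0 /\ forall x y, A x -> A y -> A (x + y).

Lemma add_closedMn A x n : add_closed A -> A x -> A (x *+ n).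
Proof.
by move=> [A0 AD] Ax; elim: n => [|n IH]; rewrite ?mulr0n // mulrS; apply: AD.
Qed.

Definition adjoin A x : G -> Prop := fun y => exists a n, A a /\ y = a + x *+ n.

Lemma sub_adjoin A x y : A y -> adjoin A x y.
Proof. by move=> Ay; exists y, 0%N; rewrite addr0. Qed.

Lemma adjoin_closed A x : add_closed A -> add_closed (adjoin A x).
Proof.
move=> [A0 AD]; split; first exact: sub_adjoin.
move=> _ _ [a [n [Aa ->]]] [b [p [Ab ->]]].
by exists (a + b), (n + p)%N; split; [apply: AD | rewrite mulrnDr addrACA].
Qed.

Definition proper_cone A := [/\ add_closed A, A u & ~ A (- u)].

Lemma proper_cone_oppMn A n : proper_cone A -> ~ A ((- u) *+ n.+1).
Proof.
move=> [Acl Au An1]; rewrite mulrS => An; apply: An1.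
rewrite -(subrK (u *+ n) (- u)) -mulNrn.
by apply: Acl.2 An _; apply: add_closedMn.
Qed.

Lemma adjoin_proper A x :
  proper_cone A -> ~ adjoin A x (- u) \/ ~ adjoin A (- x) (- u).
Proof.
move=> Ap; have [Acl Au An1] := Ap.
case: (pselect (adjoin A x (- u))); last by left.
move=> [a [[|n] [Aa ua]]]; first by case: An1; rewrite ua addr0.
right=> -[b [[|p] [Ab ub]]]; first by case: An1; rewrite ub addr0.
apply: (@proper_cone_oppMn A (p + n.+1) Ap).
have -> : (- u) *+ (p + n.+1).+1 = a *+ p.+1 + b *+ n.+1.
  rewrite -addSn mulrnDr {1}ua ub !mulrnDl -!mulrnA mulNrn [(p.+1 * _)%N]mulnC.
  by rewrite addrACA subrr addr0.
by apply: Acl.2; apply: add_closedMn.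
Qed.

Lemma chain_union_proper (C : (G -> Prop) -> Prop) :
  (exists A, C A) -> (forall A, C A -> proper_cone A) ->
  (forall A B, C A -> C B ->
    (forall x, A x -> B x) \/ (forall x, B x -> A x)) ->
  proper_cone (fun x => exists2 A, C A & A x).
Proof.
move=> [A0 CA0] Cprop Ctot; have [[A00 _] A0u _] := Cprop _ CA0; split.
- split; first by exists A0.
  move=> x y [A CA Ax] [B CB By].
  have [[[_ AD] _ _] [[_ BD] _ _]] := (Cprop _ CA, Cprop _ CB).
  have [AB|BA] := Ctot _ _ CA CB.
    by exists B => //; apply: BD => //; apply: AB.
  by exists A => //; apply: AD => //; apply: BA.
- by exists A0.
- by move=> [A CA Anu]; have [_ _] := Cprop _ CA.
Qed.

Lemma maximal_cone K : proper_cone K ->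
  exists A, [/\ proper_cone A, forall x, K x -> A x &
    forall B, proper_cone B -> (forall x, A x -> B x) -> forall x, B x -> A x].
Proof.
move=> Kp; pose above A := proper_cone A /\ forall x, K x -> A x.
pose K' : {A | above A} := exist _ K (conj Kp (fun=> id)).
pose sub (E E' : {A | above A}) := `[< forall x, sval E x -> sval E' x >].
have [||C Ctot|[A [Ap KA]] Amax] := @classical_sets.ZL_preorder _ K' sub.
- by move=> E; apply/asboolP.
- by move=> E' E D /asboolP EE' /asboolP E'D; apply/asboolP => x /EE'/E'D.
- have [[E0 CE0]|C0] := pselect (exists E, C E); last first.
    by exists K' => E CE; case: C0; exists E.
  pose C' A := exists2 E, C E & A = sval E.
  have Up : above (fun x => exists2 A, C' A & A x).
    split; last first.
      by move=> x Kx; exists (sval E0); [exists E0 | apply: (svalP E0).2].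
    apply: chain_union_proper; first by exists (sval E0), E0.
    + by move=> _ [E _ ->]; have [] := svalP E.
    + move=> _ _ [E CE ->] [E' CE' ->].
      by have [/asboolP|/asboolP] := Ctot _ _ CE CE'; [left | right].
  exists (exist _ _ Up) => E CE; apply/asboolP => x Ex.
  by exists (sval E); first exists E.
exists A; split=> // B Bp AB x Bx; have Babove : above B by split=> // z /KA/AB.
by have /asboolP := Amax (exist _ _ Babove) (introT (asboolP _) AB); apply.
Qed.

Lemma total_cone K : proper_cone K ->
  exists A, [/\ proper_cone A, forall x, K x -> A x & forall x, A x \/ A (- x)].
Proof.
move=> /maximal_cone[A [Ap KA Amax]]; exists A; split=> // x.
have [Acl Au _] := Ap.
have absorb y : ~ adjoin A y (- u) -> A y.
  move=> An1; apply: (Amax (adjoin A y)); last first.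
  - by exists 0, 1%N; rewrite add0r; split=> //; case: Acl.
  - exact: sub_adjoin.
  - by split=> //; [apply: adjoin_closed | apply: sub_adjoin].
by have [/absorb|/absorb] := adjoin_proper x Ap; [left | right].
Qed.

Section EudoxusFunctional.
Variable A : G -> Prop.
Hypotheses (A_proper : proper_cone A) (A_total : forall x, A x \/ A (- x))
  (order_unit : forall x, exists n : nat, A (u *+ n - x)).

Let A_closed : add_closed A. Proof. by case: A_proper. Qed.
Let AD x y : A x -> A y -> A (x + y). Proof. by case: A_closed => _; apply. Qed.
Let AMn x n : A x -> A (x *+ n). Proof. exact: add_closedMn. Qed.

Definition eudoxus_cut (x : G) (r : R) := exists (n : int) (q : nat),
  r = n%:~R / q.+1%:R /\ A (x *+ q.+1 - u *~ n).

Definition eudoxus x : R := sup (eudoxus_cut x).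

Lemma cone_unitMz_ge0 (n : int) : A (u *~ n) -> 0 <= n.
Proof.
case: n => // n; rewrite NegzE mulrNz -pmulrn -mulNrn => An.
by case: (proper_cone_oppMn A_proper An).
Qed.

Lemma lower_le_upper x (n n' : int) (q q' : nat) :
  A (x *+ q.+1 - u *~ n) -> A (u *~ n' - x *+ q'.+1) ->
  n%:~R / q.+1%:R <= n'%:~R / q'.+1%:R :> R.
Proof.
move=> lo up; rewrite ler_pdivrMr ?ltr0Sn // mulrAC ler_pdivlMr ?ltr0Sn //.
rewrite !pmulrn -!intrM ler_int -subr_ge0; apply: cone_unitMz_ge0.
suff -> : u *~ (n' * q.+1 - n * q'.+1) =
    (x *+ q.+1 - u *~ n) *+ q'.+1 + (u *~ n' - x *+ q'.+1) *+ q.+1.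
  by apply: AD; apply: AMn.
rewrite mulrzBr !mulrzA !mulrnBl -!mulrnA [(q'.+1 * _)%N]mulnC.
by rewrite addrACA addrC subrKA addrC.
Qed.

Lemma eudoxus_cut_has_sup x : classical_sets.has_sup (eudoxus_cut x).
Proof.
split.
  have [n] := order_unit (- x); rewrite opprK addrC => un.
  exists (- n%:~R / 1), (- n%:Z), 0%N.
  by rewrite !mulrNz opprK mulr1n.
have [n un] := order_unit x; exists (n%:Z%:~R / 1%:R) => _ [p [q [-> lo]]].
by apply: (lower_le_upper lo); rewrite mulr1n.
Qed.

Lemma eudoxus_ge x (n : int) q :
  A (x *+ q.+1 - u *~ n) -> n%:~R <= eudoxus x * q.+1%:R.
Proof.
move=> lo; rewrite -ler_pdivrMr ?ltr0Sn //.
by apply: (sup_upper_bound (eudoxus_cut_has_sup x)); exists n, q.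
Qed.

Lemma eudoxus_le x (n : int) q :
  A (u *~ n - x *+ q.+1) -> eudoxus x * q.+1%:R <= n%:~R.
Proof.
move=> up; rewrite -ler_pdivlMr ?ltr0Sn //.
apply: (ge_sup (eudoxus_cut_has_sup x).1) => _ [p [q' [-> lo]]].
exact: lower_le_upper lo up.
Qed.

Lemma cone_floor x : exists n : int, A (x - u *~ n) /\ A (u *~ (n + 1) - x).
Proof.
have [a] := order_unit (- x); rewrite opprK addrC => ua.
have [b ub] := order_unit x.
pose below i := `[< A (x + u *+ a - u *+ i) >].
have some_below : exists i, below i.
  by exists 0%N; apply/asboolP; rewrite subr0.
have below_bounded i : below i -> (i <= a + b)%N.
  move/asboolP => lo; rewrite -lez_nat -subr_ge0; apply: cone_unitMz_ge0.
  have := AD lo ub; congr A; rewrite mulrzBr -!pmulrn mulrnDr.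
  by rewrite [x + _]addrC -!addrA; congr (_ + _); rewrite addrA addrC subrKA.
case: (ex_maxnP some_below below_bounded) => i /asboolP lo imax.
exists (i%:Z - a%:Z); split.
  by move: lo; congr A; rewrite mulrzBr opprB -!pmulrn addrA.
have [/asboolP/imax|] := A_total (x + u *+ a - u *+ i.+1).
  by rewrite ltnn.
congr A; rewrite mulrzDr mulrzBr mulr1z -!pmulrn [_ - _ + u]addrAC opprB.
by rewrite mulrSr opprD addrA [RHS]addrAC.
Qed.

(* Both sides lie within [2 / q] of a common fraction, for every [q]. *)
Lemma eudoxusD : {morph eudoxus : x y / x + y}.
Proof.
move=> x y; pose gap := `|eudoxus (x + y) - (eudoxus x + eudoxus y)|.
have gap_small q : gap * q.+1%:R <= 2.
  have [n [lox upx]] := cone_floor (x *+ q.+1).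
  have [p [loy upy]] := cone_floor (y *+ q.+1).
  have loxy : A ((x + y) *+ q.+1 - u *~ (n + p)).
    by rewrite mulrnDl mulrzDr opprD addrACA; apply: AD.
  have upxy : A (u *~ (n + 1 + (p + 1)) - (x + y) *+ q.+1).
    by rewrite mulrnDl mulrzDr opprD addrACA; apply: AD.
  rewrite /gap -[q.+1%:R](@gtr0_norm R) ?ltr0Sn // -normrM ler_norml.
  move: (eudoxus_ge lox) (eudoxus_le upx) (eudoxus_ge loy) (eudoxus_le upy).
  move: (eudoxus_ge loxy) (eudoxus_le upxy); rewrite !rmorphD /=.
  by move=> *; apply/andP; split; lra.
apply/eqP; rewrite -subr_eq0 -normr_eq0; apply: contraT => gap_neq0.
have gap_gt0 : 0 < gap by rewrite lt_def gap_neq0 normr_ge0.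
have [n far] := eventually_lt_mulrn 2 gap_gt0.
by have := gap_small n; rewrite leNgt mulr_natr far.
Qed.

Lemma eudoxus_unit : eudoxus u = 1.
Proof.
have [A0 _] := A_closed.
have := @eudoxus_ge u 1 0; have := @eudoxus_le u 1 0.
rewrite !mulr1 mulr1n mulr1z subrr => /(_ A0) le1 /(_ A0) ge1.
by apply/le_anti; rewrite le1 ge1.
Qed.

Lemma eudoxus_ge0 x : A x -> 0 <= eudoxus x.
Proof.
by move=> Ax; have := @eudoxus_ge x 0 0; rewrite mulr1n subr0 mulr1; apply.
Qed.

End EudoxusFunctional.

Theorem positive_functional K : proper_cone K ->
  (forall x, exists n : nat, K (u *+ n - x)) ->
  exists phi : {additive G -> R}, phi u = 1 /\ forall x, K x -> 0 <= phi x.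
Proof.
move=> Kp Kunit; have [A [Ap KA Atot]] := total_cone Kp.
have Aunit x : exists n : nat, A (u *+ n - x).
  by have [n /KA] := Kunit x; exists n.
have phiB : zmod_morphism (eudoxus A).
  by move=> x y; apply/esym; rewrite -{1}(subrK y x) eudoxusD // addrK.
exists (HB.pack_for {additive G -> R} (eudoxus A)
  (GRing.isZmodMorphism.Build G R _ phiB)).
by split=> [|x /KA]; [apply: eudoxus_unit | apply: eudoxus_ge0].
Qed.

End PositiveFunctional.

Section PositiveFunctionalFfun.
Local Open Scope ring_scope.
Variables (T : finType) (K : {ffun T -> int} -> Prop).
Hypotheses (K_closed : add_closed K) (K_single : forall x, K (single x)).

Lemma add_closed_ge0 (v : {ffun T -> int}) : (forall x, 0 <= v x) -> K v.
Proof.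
have [K0 KD] := K_closed; move=> v0; rewrite -[v]linext_id.
apply: (big_ind K) => // x _; case: (v x) (v0 x) => // n _; rewrite -pmulrn.
exact: add_closedMn.
Qed.

Lemma ones_order_unit (v : {ffun T -> int}) :
  exists n : nat, K ([ffun=> 1] *+ n - v).
Proof.
exists (\sum_x `|v x|)%N; apply: add_closed_ge0 => x.
by rewrite ffunE ffunMnE !ffunE natz (bigD1 x) //= subr_ge0; lia.
Qed.

Lemma positive_functional_ffun (R : realType) : ~ K (- [ffun=> 1]) ->
  exists delta : T -> R, [/\ forall x, 0 <= delta x, \sum_x delta x = 1 &
    forall v, K v -> 0 <= linext delta v].
Proof.
move=> Kn1; have K1 : K [ffun=> 1] by apply: add_closed_ge0 => x; rewrite ffunE.
have [//|phi [phi1 phiK]] :=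
  @positive_functional R _ [ffun=> 1] K _ ones_order_unit.
exists (fun x => phi (single x)); split=> [x||v Kv]; first exact/phiK/K_single.
  by rewrite -phi1 additive_linext; apply: eq_bigr => x _; rewrite ffunE mulr1z.
by rewrite -additive_linext phiK.
Qed.

End PositiveFunctionalFfun.

(** * Permutations and exchanges of finite sets *)

Section Permutations.
Variable T : finType.
Implicit Types (tau : {perm T}) (s t : seq T) (A B X Y Z : {set T}).

Lemma perm_of_uniq_seqs s t : uniq s -> uniq t -> size s = size t ->
  exists tau, map tau s = t.
Proof.
move=> us ut est; have leT : size s <= #|T|.
  by rewrite -(card_uniqP us) max_card.
have dt r (er : size r == size s) :
    uniq r -> Tuple er \in (size s).-dtuple([set: T]).
  by move=> ur; rewrite inE ur; apply/fintype.subsetP => x; rewrite inE.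
have [tau _ /(congr1 val)/= ->] :=
  atransP2 (ntransitive_weak leT (Sym_trans T)) (dt _ (eqxx _) us)
    (dt _ (introT eqP (esym est)) ut).
by exists tau.
Qed.

Lemma imset_permK tau : cancel (fun X => tau @: X) (fun X => tau^-1%g @: X).
Proof. exact: (actK 'P^*%act tau). Qed.

Lemma imset_permKV tau : cancel (fun X => tau^-1%g @: X) (fun X => tau @: X).
Proof. exact: (actKV 'P^*%act tau). Qed.

Lemma imset_perm_inj tau : injective (fun X => tau @: X).
Proof. exact: can_inj (imset_permK tau). Qed.

Lemma imset_permM tau rho X : (tau * rho)%g @: X = rho @: (tau @: X).
Proof. exact: (actM 'P^*%act X tau rho). Qed.

Lemma card_imset_perm tau X : #|tau @: X| = #|X|.
Proof. exact: (card_setact 'P%act X tau). Qed.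

Lemma imset_permI tau X Y : tau @: (X :&: Y) = tau @: X :&: tau @: Y.
Proof. by apply: imsetI => x y _ _; apply: perm_inj. Qed.

Lemma mem_imset_perm tau X x : (tau x \in tau @: X) = (x \in X).
Proof. exact/mem_imset/perm_inj. Qed.

Lemma imset_map_enum tau A B : map tau (enum A) = enum B -> tau @: A = B.
Proof.
move=> e; apply/setP => x; rewrite -[RHS]mem_enum -e.
by apply/imsetP/mapP => -[y yA ->]; exists y; rewrite ?mem_enum // -mem_enum.
Qed.

Lemma imset_perm_transitive A B : #|A| = #|B| -> exists tau, tau @: A = B.
Proof.
rewrite !cardE => eAB.
have [tau tauE] := perm_of_uniq_seqs (enum_uniq A) (enum_uniq B) eAB.
by exists tau; apply: imset_map_enum.
Qed.

Lemma exists_perm_flag a b a' b' Y Z Y' Z' :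
  a != b -> a \notin Z -> b \notin Z -> Y \subset Z ->
  a' != b' -> a' \notin Z' -> b' \notin Z' -> Y' \subset Z' ->
  #|Y| = #|Y'| -> #|Z| = #|Z'| ->
  exists tau, [/\ tau a = a', tau b = b', tau @: Y = Y' & tau @: Z = Z'].
Proof.
pose flag (x y : T) A B := [:: x, y & enum A ++ enum (B :\: A)].
have flag_uniq x y A B : x != y -> x \notin B -> y \notin B -> A \subset B ->
    uniq (flag x y A B).
  move=> xy xB yB AB; rewrite /= inE !mem_cat !mem_enum !inE !negb_or xy.
  rewrite !negb_and xB yB !orbT !(contraNN (fintype.subsetP AB _)) //=.
  rewrite cat_uniq !enum_uniq andbT.
  by apply/hasPn => z; rewrite !mem_enum inE => /andP[].
move=> ab aZ bZ YZ a'b' aZ' bZ' YZ' eY eZ.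
have eD : #|Z :\: Y| = #|Z' :\: Y'|.
  by rewrite !cardsD (setIidPr YZ) (setIidPr YZ') eY eZ.
have [|tau [ta tb]] := perm_of_uniq_seqs (flag_uniq _ _ _ _ ab aZ bZ YZ)
  (flag_uniq _ _ _ _ a'b' aZ' bZ' YZ').
  by rewrite /= !size_cat -!cardE eY eD.
rewrite map_cat => /eqP; rewrite eqseq_cat ?size_map -?cardE //.
move=> /andP[/eqP/imset_map_enum tauY /eqP/imset_map_enum tauD].
exists tau; split=> //; rewrite -[in LHS](setID Z Y) -[in RHS](setID Z' Y').
by rewrite imsetU (setIidPr YZ) (setIidPr YZ') tauY tauD.
Qed.

Lemma imset_tperm_fix a b X : (a \in X) = (b \in X) -> tperm a b @: X = X.
Proof.
move=> ab; apply/setP => x; rewrite -[x in LHS](tpermK a b) mem_imset_perm.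
by case: tpermP => [->|->|] //; rewrite ab.
Qed.

End Permutations.

Lemma exists_involution (T : eqType) (s t : seq T) :
  uniq (s ++ t) -> size s = size t ->
  exists2 swap : T -> T, involutive swap &
    map swap s = t /\ forall x, x \notin s ++ t -> swap x = x.
Proof.
rewrite cat_uniq => /and3P[us /hasPn st ut] est.
pose swap x := if x \in s then nth x t (index x s)
             else if x \in t then nth x s (index x t) else x.
exists swap; last first.
  split=> [|x]; last first.
    by rewrite mem_cat negb_or /swap => /andP[/negbTE -> /negbTE ->].
  case: s us est @swap {st} => [|x0 s] us est swap; first by case: (t) est.
  apply: (@eq_from_nth _ x0); rewrite size_map // => i i_lt.
  rewrite (nth_map x0) // /swap mem_nth // index_uniq //.
  by apply: set_nth_default; rewrite -est.
move=> x; rewrite {2}/swap; case: ifP => xs.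
  have yt : nth x t (index x s) \in t by rewrite mem_nth // -est index_mem.
  rewrite /swap (negbTE (st _ yt)) yt index_uniq -?est ?index_mem //.
  by rewrite -[RHS](nth_index x xs); apply: set_nth_default; rewrite index_mem.
case: ifP => xt; last by rewrite /swap xs xt.
have ys : nth x s (index x t) \in s by rewrite mem_nth // est index_mem.
rewrite /swap ys index_uniq ?est ?index_mem //.
by rewrite -[RHS](nth_index x xt); apply: set_nth_default; rewrite index_mem.
Qed.

Lemma perm_map_matching (S : Type) (T U : eqType) (phi : S -> U) (psi : T -> U)
    (s : seq S) (t : seq T) :
  perm_eq (map phi s) (map psi t) ->
  exists2 t', perm_eq t' t & map phi s = map psi t'.
Proof.
case: t => [|x0 t] /=; first by move/perm_nilP => ->; exists [::].
rewrite -/(map psi (x0 :: t)); move: (x0 :: t) => {}t.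
case/(perm_iotaP (psi x0))=> Is pIs ->; rewrite size_map in pIs.
exists [seq nth x0 t i | i <- Is].
  by apply: perm_trans (perm_map _ pIs) _; rewrite -/(mkseq _ _) mkseq_nth.
rewrite -map_comp; apply/eq_in_map => i; rewrite (perm_mem pIs) mem_iota => it.
by rewrite /= (nth_map x0).
Qed.

Section Subsets.
Variable T : finType.
Implicit Types (a b x : T) (A B V W X Z : {set T}).

Lemma exists_subset_card A B n : A \subset B -> #|A| <= n <= #|B| ->
  exists D : {set T}, [/\ A \subset D, D \subset B & #|D| = n].
Proof.
move=> AB /andP[An nB]; have : 0 < 'C(#|B :\: A|, n - #|A|).
  by rewrite bin_gt0 cardsD (setIidPr AB) leq_sub2r.
rewrite -cards_draws => /card_gt0P[D]; rewrite inE subsetD.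
move=> /andP[/andP[DB DA] /eqP cD].
exists (A :|: D); rewrite subsetUl subUset AB DB; split=> //.
by rewrite cardsU setIC (disjoint_setI0 DA) cards0 subn0 cD subnKC.
Qed.

Lemma exists_subset_ord B (n : 'I_#|B|.+1) :
  exists2 D : {set T}, D \subset B & #|D| = n.
Proof.
have [|D [_ DB Dn]] := exists_subset_card (n := n) (sub0set B).
  by rewrite cards0 /= -ltnS ltn_ord.
by exists D.
Qed.

Lemma card_draws_mem B x j : x \in B ->
  #|[set D : {set T} | [&& D \subset B, #|D| == j.+1 & x \in D]]|
    = 'C(#|B|.-1, j).
Proof.
move=> xB; have -> : #|B|.-1 = #|B :\ x| by rewrite (cardsD1 x B) xB.
rewrite -cards_draws -[RHS](@card_in_imset _ _ (fun D => x |: D)).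
  apply: eq_card => D; rewrite inE.
  apply/and3P/imsetP => [[DB /eqP cD xD]|[D']].
    exists (D :\ x); last by rewrite setD1K.
    by rewrite inE setSD //= -eqSS -cD (cardsD1 x D) xD.
  rewrite inE => /andP[D'B /eqP cD'] ->.
  have xD' : x \notin D'.
    by apply/negP => /(fintype.subsetP D'B); rewrite !inE eqxx.
  rewrite subUset sub1set xB (subset_trans D'B) ?subsetDl //.
  by rewrite cardsU1 xD' cD' setU11.
move=> D D'; rewrite !inE !subsetD1.
move=> /andP[/andP[_ xD] _] /andP[/andP[_ xD'] _] e.
by rewrite -(setU1K xD) e setU1K.
Qed.

Lemma card_setIU1 X Z x :
  x \notin Z -> #|X :&: (x |: Z)| = (x \in X) + #|X :&: Z|.
Proof.
move=> xZ; have xXZ : [disjoint X :&: [set x] & X :&: Z].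
  rewrite -setI_eq0 setIACA setIid [_ :&: Z]disjoint_setI0 ?setI0 //.
  by rewrite disjoints1.
rewrite setIUr cardsU (disjoint_setI0 xXZ) cards0 subn0; congr (_ + _).
case: (boolP (x \in X)) => xX; first by rewrite (setIidPr _) ?cards1 ?sub1set.
by rewrite setIC disjoint_setI0 ?cards0 // disjoints1.
Qed.

Lemma cardsD_sym W X : #|W| = #|X| -> #|W :\: X| = #|X :\: W|.
Proof. by move=> e; rewrite !cardsD e setIC. Qed.

Lemma eq_card_subsetP W X : #|W| = #|X| -> reflect (W = X) (W \subset X).
Proof.
move=> e; apply: (iffP idP) => [WX|-> //].
by apply/eqP; rewrite eqEcard WX e leqnn.
Qed.

Lemma card_exchange W a b : a \in W -> b \notin W -> #|b |: (W :\ a)| = #|W|.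
Proof.
by move=> aW bW; rewrite cardsU1 !inE (negbTE bW) andbF (cardsD1 a W) aW.
Qed.

Lemma exists_exchange W X : #|W| = #|X| -> W != X ->
  exists a b, a \in W :\: X /\ b \in X :\: W.
Proof.
move=> e WX; have : W :\: X != set0.
  by rewrite setD_eq0; apply: contraNN WX => /(eq_card_subsetP e) ->.
have : X :\: W != set0.
  by rewrite setD_eq0; apply: contraNN WX => /(eq_card_subsetP (esym e)) ->.
by move=> /set0Pn[b bX] /set0Pn[a aW]; exists a, b.
Qed.

Lemma card_exchangeD W a b : #|W :\: (b |: (W :\ a))| <= 1.
Proof.
rewrite -(cards1 a); apply/subset_leq_card/fintype.subsetP => x; rewrite !inE.
by case: (x == a) => //; case: (x \in W); rewrite ?orbT ?andbF.
Qed.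

Lemma sum_mem W X : \sum_(x in W) (x \in X : nat) = #|W :&: X|.
Proof.
rewrite -sum1_card [RHS]big_mkcond [LHS]big_mkcond; apply: eq_bigr => x _.
by rewrite inE; case: (x \in W); case: (x \in X).
Qed.

Definition between W X V := (W :&: X \subset V) && (V \subset W :|: X).

Lemma betweenC W X V : between W X V = between X W V.
Proof. by rewrite /between setIC setUC. Qed.

Lemma between_cardDl W X V : #|V| = #|W| -> between W X V -> V != W ->
  #|V :\: X| < #|W :\: X|.
Proof.
move=> e /andP[/fintype.subsetP lo /fintype.subsetP up] VW.
have [x [a [_ /setDP[aW aV]]]] := exists_exchange e VW.
apply/proper_card/properP; split.
  apply/fintype.subsetP => y; rewrite !inE => /andP[yX /up].
  by rewrite inE (negbTE yX) orbF.
exists a; rewrite !inE ?aW ?(negbTE aV) ?andbF //.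
by rewrite andbT; apply: contraNN aV => aX; rewrite lo // inE aW.
Qed.

Lemma between_cardDr W X V : #|V| = #|X| -> between W X V -> V != X ->
  #|W :\: V| < #|W :\: X|.
Proof.
move=> e /andP[/fintype.subsetP lo /fintype.subsetP up] VX.
have [a [b [/setDP[aV aX] _]]] := exists_exchange e VX.
apply/proper_card/properP; split.
  apply/fintype.subsetP => y; rewrite !inE => /andP[yV yW]; rewrite yW andbT.
  by apply: contraNN yV => yX; rewrite lo // inE yW.
exists a; rewrite !inE ?aX ?aV //=.
by have := up a aV; rewrite inE (negbTE aX) orbF.
Qed.

Lemma exists_between W X : #|W| = #|X| -> 1 < #|W :\: X| ->
  exists V, [/\ #|V| = #|W|, between W X V, V != W & V != X].
Proof.
move=> e dWX.
have WX : W != X by apply: contraTneq dWX => ->; rewrite setDv cards0.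
have [a [b [aWX /setDP[bX bW]]]] := exists_exchange e WX.
have [aW aX] := setDP aWX.
exists (b |: (W :\ a)); rewrite card_exchange //; split=> //.
- apply/andP; split; apply/fintype.subsetP => x; rewrite !inE.
    by case/andP=> -> xX; rewrite (contraTneq _ xX) ?orbT // => ->.
  by case/orP=> [/eqP->|/andP[_ ->//]]; rewrite bX orbT.
- by apply: contraNneq bW => <-; rewrite !inE eqxx.
- move: dWX; rewrite (cardsD1 a) aWX ltnS => /card_gt0P[c].
  rewrite !inE => /and3P[ca cX cW].
  by apply: contraNneq cX => <-; rewrite !inE ca cW orbT.
Qed.

Lemma adjacent_sets W X : #|W| = #|X| -> #|W :\: X| = 1 ->
  exists Z a b, [/\ a \notin Z, b \notin Z, W = a |: Z & X = b |: Z].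
Proof.
move=> e WX1; have XW1 := esym (cardsD_sym e); rewrite WX1 in XW1.
have [/cards1P[a Wa] /cards1P[b Xb]] := (introT eqP WX1, introT eqP XW1).
exists (W :&: X), a, b.
have aWX : a \in W :\: X by rewrite Wa set11.
have bXW : b \in X :\: W by rewrite Xb set11.
move: aWX bXW; rewrite !inE => /andP[aX _] /andP[bW _].
rewrite -Wa -Xb setUC setID setUC setIC setID.
by split; rewrite ?(negbTE aX) ?(negbTE bW) ?andbF.
Qed.

Lemma exchange_boundary (S : {set {set T}}) W X :
  #|W| = #|X| -> W \in S -> X \notin S ->
  exists (Z : {set T}) a b,
    [/\ a \notin Z, b \notin Z, a |: Z \in S & b |: Z \notin S].
Proof.
elim: {W}_.+1 {-2}W (ltnSn #|W :\: X|) => // n IH W dWX e WS XS.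
have WX : W != X by apply: contraNneq XS => <-.
have [a [b [aWX bXW]]] := exists_exchange e WX.
have [[aW aX] [bX bW]] := (setDP aWX, setDP bXW).
have [MS|MS] := boolP (b |: (W :\ a) \in S); last first.
  by exists (W :\ a), a, b; rewrite !inE eqxx (negbTE bW) andbF setD1K.
apply: (IH (b |: (W :\ a))) => //; last by rewrite card_exchange.
rewrite ltnS in dWX; apply: leq_trans dWX.
rewrite (cardsD1 a (W :\: X)) aWX ltnS.
apply/subset_leq_card/fintype.subsetP => x; rewrite !inE => /andP[xX].
by case: eqVneq xX => [->|_ xX]; [rewrite bX | rewrite xX].
Qed.

End Subsets.

(** * Ballot weights and rules on them *)

(* The value at the empty set is junk, since no ballot is empty. *)
Notation weight C := {ffun {set C} -> int}.

Section Weights.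
Local Open Scope ring_scope.
Variable C : finType.
Implicit Types (tau : {perm C}) (v : weight C) (W X : {set C}).

Definition perm_weight tau v : weight C :=
  [ffun X : {set C} => v (tau^-1%g @: X)].

Fact perm_weight_is_zmod_morphism tau : zmod_morphism (perm_weight tau).
Proof. by move=> v w; apply/ffunP => X; rewrite !ffunE. Qed.

HB.instance Definition _ tau :=
  GRing.isZmodMorphism.Build (weight C) (weight C) (perm_weight tau)
    (perm_weight_is_zmod_morphism tau).

Lemma perm_weight_single tau X : perm_weight tau (single X) = single (tau @: X).
Proof.
apply/ffunP => Y; rewrite !ffunE; congr (Posz (nat_of_bool _)).
exact: (can2_eq (imset_permKV tau) (imset_permK tau)).
Qed.

Lemma perm_weight_cst tau (n : int) : perm_weight tau [ffun=> n] = [ffun=> n].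
Proof. by apply/ffunP => X; rewrite !ffunE. Qed.

Lemma perm_weight1 v : perm_weight 1 v = v.
Proof. by apply/ffunP => X; rewrite ffunE invg1 imset_perm1. Qed.

Variables (R : realType) (s : nat -> R).

Definition score W : weight C -> R := linext (fun X => s #|X :&: W|).

HB.instance Definition _ W :=
  GRing.isZmodMorphism.Build (weight C) R (score W) (linext_is_zmod_morphism _).

Lemma score_single W X : score W (single X) = s #|X :&: W|.
Proof. exact: linext_single. Qed.

Lemma score_perm_weight tau W v :
  score (tau @: W) (perm_weight tau v) = score W v.
Proof.
move: v.
apply: (@eq_additive _ _ (score (tau @: W) \o perm_weight tau)) => X /=.
by rewrite perm_weight_single !score_single -imset_permI card_imset_perm.
Qed.

End Weights.

Section Argmax.
Local Open Scope ring_scope.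
Variables (R : realType) (C : finType) (k : nat).
Implicit Types (phi psi : {set C} -> R) (W : {set C}).

Definition argmax phi : {set {set C}} := [set W : {set C} | (#|W| == k) &&
  [forall W' : {set C}, (#|W'| == k) ==> (phi W' <= phi W)]].

Lemma argmaxP phi W :
  reflect (#|W| = k /\ forall W' : {set C}, #|W'| = k -> phi W' <= phi W)
    (W \in argmax phi).
Proof.
rewrite inE; apply: (iffP andP) => [[/eqP Wk /forallP max]|[Wk max]].
  by split=> // W' W'k; have := max W'; rewrite W'k eqxx.
by split; [apply/eqP | apply/forallP => W'; apply/implyP => /eqP/max].
Qed.

Lemma eq_argmax phi psi : phi =1 psi -> argmax phi = argmax psi.
Proof.
move=> e; apply/setP => W; rewrite !inE; congr (_ && _).
by apply: eq_forallb => W'; rewrite !e.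
Qed.

End Argmax.

Record weight_rule (C : finType) k (F : weight C -> {set {set C}}) : Prop :=
  WeightRule {
    rule_neq0 : forall v, F v != set0;
    rule_card : forall v W, W \in F v -> #|W| = k;
    rule_shift : forall v (n : int), F (v + [ffun=> n])%R = F v;
    rule_perm : forall (tau : {perm C}) v (W : {set C}),
      (tau @: W \in F (perm_weight tau v)) = (W \in F v);
    rule_add : forall v w W, W \in F v -> W \in F w ->
      F (v + w)%R = F v :&: F w;
    rule_continuous : forall v w, exists n, F (v *+ n + w)%R \subset F v;
    rule_losers : forall W X X' : {set C}, #|W| = k ->
      X' != set0 -> X' \subset X -> W :&: X' = W :&: X ->
      W \in F (single X' - single X)%R }.

Section WeightRuleTheory.
Local Open Scope ring_scope.
Variables (C : finType) (k : nat) (F : weight C -> {set {set C}}).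
Hypothesis F_rule : weight_rule k F.
Implicit Types (v w : weight C) (W X : {set C}).

Lemma rule_perm_fixed (tau : {perm C}) v W :
  perm_weight tau v = v -> (tau @: W \in F v) = (W \in F v).
Proof. by move=> {1}<-; apply: (rule_perm F_rule). Qed.

Lemma rule_zero W : #|W| = k -> W \in F 0.
Proof.
have [W0 W0F] := set0Pn _ (rule_neq0 F_rule 0).
rewrite -(rule_card F_rule W0F) => /esym/imset_perm_transitive[tau <-].
by rewrite rule_perm_fixed ?raddf0.
Qed.

Lemma ruleD v w W : W \in F v -> W \in F w -> W \in F (v + w).
Proof. by move=> Wv Ww; rewrite (rule_add F_rule Wv Ww) inE Wv. Qed.

Lemma ruleD_inv v w W X :
  W \in F v -> W \in F w -> X \in F (v + w) -> X \in F v.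
Proof. by move=> Wv Ww; rewrite (rule_add F_rule Wv Ww) inE => /andP[]. Qed.

Lemma ruleMn v n W : W \in F v -> W \in F (v *+ n).
Proof.
move=> Wv; elim: n => [|n IH]; first exact/rule_zero/(rule_card F_rule Wv).
by rewrite mulrS ruleD.
Qed.

Lemma rule_sum (I : finType) (P : pred I) (E : I -> weight C) W : #|W| = k ->
  (forall i, P i -> W \in F (E i)) -> W \in F (\sum_(i | P i) E i).
Proof.
move=> Wk WE; apply: (big_ind (fun v => W \in F v)) => //.
  exact: rule_zero.
by move=> v w; apply: ruleD.
Qed.

Lemma rule_sum_inv (I : finType) (P : pred I) (E : I -> weight C) W X i : P i ->
  (forall i, P i -> W \in F (E i)) ->
  X \in F (\sum_(i | P i) E i) -> X \in F (E i).
Proof.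
move=> Pi WE; rewrite (bigD1 i) //=; apply: (@ruleD_inv _ _ W); first exact: WE.
apply: rule_sum => [|l /andP[Pl _]]; last exact: WE.
exact: rule_card F_rule _ _ (WE i Pi).
Qed.

End WeightRuleTheory.

Section SwapDifference.
Local Open Scope ring_scope.
Variables (C : finType) (Z : {set C}) (a b : C).
Implicit Types (v : weight C) (X : {set C}).

Definition swap_sign X : int := (a \in X)%:Z - (b \in X)%:Z.

(* Only ballots containing exactly one of [a], [b] distinguish [a |: Z] from
   [b |: Z], and only through their intersection size with [Z]. *)
Definition swap_diff : weight C -> {ffun 'I_#|Z|.+1 -> int} :=
  linext (fun X => single (inord #|X :&: Z|) *~ swap_sign X).

HB.instance Definition _ := GRing.isZmodMorphism.Build (weight C)
  {ffun 'I_#|Z|.+1 -> int} swap_diff (linext_is_zmod_morphism _).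

Lemma swap_diff_single X :
  swap_diff (single X) = single (inord #|X :&: Z|) *~ swap_sign X.
Proof. exact: linext_single. Qed.

Hypotheses (aZ : a \notin Z) (bZ : b \notin Z).

Lemma tperm_fix : tperm a b @: Z = Z.
Proof. by apply: imset_tperm_fix; rewrite (negbTE aZ) (negbTE bZ). Qed.

Lemma card_capZ_tperm X : #|(tperm a b @: X) :&: Z| = #|X :&: Z|.
Proof. by rewrite -[in LHS]tperm_fix -imset_permI card_imset_perm. Qed.

Lemma swap_sign_tperm X : swap_sign (tperm a b @: X) = - swap_sign X.
Proof.
rewrite /swap_sign -(mem_imset_perm (tperm a b) X a).
by rewrite -(mem_imset_perm (tperm a b) X b) tpermL tpermR opprB.
Qed.

Lemma swap_diff_tperm v : swap_diff (perm_weight (tperm a b) v) = - swap_diff v.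
Proof.
move: v; apply: (@eq_additive _ _ (swap_diff \o perm_weight _)
  (-%R \o swap_diff)) => X /=.
rewrite perm_weight_single !swap_diff_single card_capZ_tperm.
by rewrite swap_sign_tperm mulrNz.
Qed.

Lemma swap_diff_cst (n : int) : swap_diff [ffun=> n] = 0.
Proof.
have := swap_diff_tperm [ffun=> n]; rewrite perm_weight_cst.
move: (swap_diff _) => d /ffunP dN; apply/ffunP => l.
by have /eqP := dN l; rewrite !ffunE -addr_eq0 -mulr2n mulrn_eq0 => /eqP.
Qed.

Lemma score_swap (R : realType) (s : nat -> R) (delta : 'I_#|Z|.+1 -> R) v :
  (forall l : 'I_#|Z|.+1, delta l = s l.+1 - s l) ->
  score s (a |: Z) v - score s (b |: Z) v = linext delta (swap_diff v).
Proof.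
move=> deltaE; move: v; apply: (@eq_additive _ _
  (score s (a |: Z) \- score s (b |: Z)) (linext delta \o swap_diff)) => X /=.
rewrite !score_single swap_diff_single.
rewrite raddfMz /= linext_single deltaE.
rewrite inordK ?ltnS ?subset_leq_card ?subsetIr // !card_setIU1 // /swap_sign.
by case: (a \in X); case: (b \in X);
  rewrite /= ?subrr ?mulr0z ?subr0 ?mulr1z ?sub0r ?mulrNz ?mulr1z ?opprB.
Qed.

End SwapDifference.

(** * Votes that do not separate two adjacent committees *)

Section SwapInvariance.
Local Open Scope ring_scope.
Variables (C : finType) (k : nat) (F : weight C -> {set {set C}}).
Hypothesis F_rule : weight_rule k F.
Variables (Z : {set C}) (a b : C).
Hypotheses (aZ : a \notin Z) (bZ : b \notin Z) (ab : a != b).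
Implicit Types (v : weight C) (W X Y : {set C}) (tau : {perm C}).

Let swap := tperm a b.

Definition stabiliser : {set {perm C}} :=
  [set tau : {perm C} | [&& tau a == a, tau b == b & tau @: Z == Z]].

Lemma stabiliserP tau :
  reflect [/\ tau a = a, tau b = b & tau @: Z = Z] (tau \in stabiliser).
Proof. by rewrite inE; apply: (iffP and3P) => -[/eqP ? /eqP ? /eqP ?]. Qed.

Lemma stabiliserM h tau :
  h \in stabiliser -> (h * tau \in stabiliser)%g = (tau \in stabiliser).
Proof.
by case/stabiliserP=> ha hb hZ; rewrite !inE !permM ha hb imset_permM hZ.
Qed.

Definition orbit_sum X : weight C := \sum_(tau in stabiliser) single (tau @: X).

Lemma orbit_sum_imset h X :
  h \in stabiliser -> orbit_sum (h @: X) = orbit_sum X.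
Proof.
move=> hH; rewrite /orbit_sum [RHS](reindex_inj (mulgI h)) /=.
by apply: eq_big => tau; rewrite ?stabiliserM // imset_permM.
Qed.

Lemma orbit_sum_swap X : perm_weight swap (orbit_sum X) = orbit_sum (swap @: X).
Proof.
rewrite raddf_sum; apply: eq_bigr => tau /stabiliserP[ta tb _] /=.
rewrite perm_weight_single -!imset_permM.
suff -> : (tau * swap = swap * tau)%g by [].
apply/permP => x; rewrite !permM /swap.
case: (tpermP a b x) => [->|->|/eqP xa /eqP xb].
- by rewrite ta !tpermL.
- by rewrite tb !tpermR.
- rewrite tpermD // eq_sym; first by rewrite -ta (inj_eq perm_inj).
  by rewrite -tb (inj_eq perm_inj).
Qed.

Lemma orbit_sum_eq X Y c : c \in [set a; b] -> X \subset Z -> Y \subset Z ->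
  #|X| = #|Y| -> orbit_sum (c |: X) = orbit_sum (c |: Y).
Proof.
move=> cab XZ YZ eXY.
have [tau [ta tb tX tZ]] := exists_perm_flag ab aZ bZ XZ ab aZ bZ YZ eXY erefl.
rewrite -[LHS](orbit_sum_imset (h := tau)); last by apply/stabiliserP.
by rewrite imsetU1 tX; case/set2P: cab => ->; rewrite ?ta ?tb.
Qed.

Definition average : weight C -> weight C := linext orbit_sum.

HB.instance Definition _ := GRing.isZmodMorphism.Build (weight C) (weight C)
  average (linext_is_zmod_morphism _).

Lemma average_single X : average (single X) = orbit_sum X.
Proof. exact: linext_single. Qed.

Lemma averageE v : average v = \sum_(tau in stabiliser) perm_weight tau v.
Proof.
rewrite /average /linext /orbit_sum; under eq_bigr do rewrite mulrz_suml.
rewrite exchange_big; apply: eq_bigr => tau _ /=.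
rewrite [RHS]additive_linext; apply: eq_bigr => X _ /=.
by rewrite perm_weight_single.
Qed.

(* Independence of losers allows a ballot containing exactly one of [a], [b] to
   be cut down to [a |: (b |: Z)]; what remains of it is determined, up to the
   stabiliser, by its intersection size with [Z]. *)
Definition trim X :=
  if (a \in X) == (b \in X) then X else X :&: (a |: (b |: Z)).

Definition trim_weight : weight C -> weight C :=
  linext (fun X => single (trim X)).

HB.instance Definition _ := GRing.isZmodMorphism.Build (weight C) (weight C)
  trim_weight (linext_is_zmod_morphism _).

Lemma trim_weight_single X : trim_weight (single X) = single (trim X).
Proof. exact: linext_single. Qed.

Lemma swap_average_trim X Y : Y \subset Z -> #|Y| = #|X :&: Z| ->
  perm_weight swap (orbit_sum (trim X)) - orbit_sum (trim X) =
  (orbit_sum (b |: Y) - orbit_sum (a |: Y)) *~ swap_sign a b X.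
Proof.
move=> YZ eY; have fixS (S : {set C}) : S \subset Z -> swap @: S = S.
  move=> SZ; apply: imset_tperm_fix.
  by rewrite !(contraNF (fintype.subsetP SZ _)).
have orbit_cap c :
    c \in [set a; b] -> orbit_sum (c |: (X :&: Z)) = orbit_sum (c |: Y).
  by move=> cab; apply: orbit_sum_eq; rewrite ?subsetIr.
rewrite /trim /swap_sign orbit_sum_swap.
case: (boolP (a \in X)); case: (boolP (b \in X)) => bX aX /=.
- by rewrite imset_tperm_fix ?aX ?bX // !subrr mulr0z.
- have -> : X :&: (a |: (b |: Z)) = a |: (X :&: Z).
    apply/setP => x; rewrite !inE.
    case: (eqVneq x a) => [->|_]; first by rewrite aX.
    by case: (eqVneq x b) => [->|//]; rewrite (negbTE bX).
  by rewrite imsetU1 fixS ?subsetIr // tpermL !orbit_cap ?set21 ?set22.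
- have -> : X :&: (a |: (b |: Z)) = b |: (X :&: Z).
    apply/setP => x; rewrite !inE.
    case: (eqVneq x b) => [->|_]; first by rewrite bX orbT.
    by case: (eqVneq x a) => [->|//]; rewrite (negbTE aX).
  rewrite imsetU1 fixS ?subsetIr // tpermR !orbit_cap ?set21 ?set22 //.
  by rewrite sub0r mulrNz mulr1z opprB.
- rewrite imset_tperm_fix ?(negbTE aX) ?(negbTE bX) //.
  by rewrite !subrr mulr0z.
Qed.

Lemma swap_average v : swap_diff Z a b v = 0 ->
  perm_weight swap (average (trim_weight v)) = average (trim_weight v).
Proof.
have [rep rep_sub rep_card] := fin_all_exists2 (@exists_subset_ord _ Z).
pose step l := orbit_sum (b |: rep l) - orbit_sum (a |: rep l).
pose trimmed := average \o trim_weight.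
suff diffE : (perm_weight swap \o trimmed) \- trimmed
    =1 linext step \o swap_diff Z a b.
  by move=> v0; apply/eqP; rewrite -subr_eq0 [_ - _]diffE /= v0 raddf0.
apply: eq_additive => X /=; rewrite trim_weight_single average_single.
rewrite swap_diff_single raddfMz /= linext_single.
apply: swap_average_trim => //.
by rewrite rep_card inordK // ltnS subset_leq_card ?subsetIr.
Qed.

Lemma trim_rule v W : #|W| = k -> W \subset a |: (b |: Z) ->
  (forall X, 0 <= v X) -> W \in F (trim_weight v - v).
Proof.
move=> Wk Wab v0; rewrite -{2}[v]linext_id /trim_weight /linext -sumrB.
apply: (rule_sum F_rule) => // X _; rewrite -mulrzBl.
case: (v X) (v0 X) => // n _; rewrite -pmulrn; apply: (ruleMn F_rule).
rewrite /trim; case: eqVneq => abX; first by rewrite subrr (rule_zero F_rule).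
apply: (rule_losers F_rule) => //; rewrite ?subsetIl //.
  apply: contraNneq abX => /setP X0; have := X0 a; have := X0 b.
  by rewrite !inE !eqxx !orbT !andbT => -> ->.
by rewrite setIA [W :&: X]setIC -setIA (setIidPl Wab) setIC.
Qed.

Lemma swap_diff_eq0_ge0 v : (forall X, 0 <= v X) -> swap_diff Z a b v = 0 ->
  a |: Z \in F v -> b |: Z \in F v.
Proof.
move=> v0 dv aF; have ak := rule_card F_rule aF.
have bk : #|b |: Z| = k by rewrite -ak !cardsU1 aZ bZ.
have a_trim : a |: Z \in F (trim_weight v - v).
  by rewrite trim_rule // setUS ?subsetUr.
have b_trim : b |: Z \in F (trim_weight v - v).
  by rewrite trim_rule // subsetUr.
have trimE : trim_weight v = v + (trim_weight v - v) by rewrite addrC subrK.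
have a_orbit tau : tau \in stabiliser ->
    a |: Z \in F (perm_weight tau (trim_weight v)).
  case/stabiliserP=> ta _ tZ.
  have -> : a |: Z = tau @: (a |: Z) by rewrite imsetU1 ta tZ.
  by rewrite (rule_perm F_rule) trimE (ruleD F_rule).
have b_average : b |: Z \in F (average (trim_weight v)).
  have -> : b |: Z = swap @: (a |: Z) by rewrite imsetU1 tpermL tperm_fix.
  rewrite (rule_perm_fixed F_rule) ?swap_average // averageE.
  exact: (rule_sum F_rule).
have one_stab : 1%g \in stabiliser.
  by apply/stabiliserP; rewrite !perm1 imset_perm1.
rewrite averageE in b_average.
have := rule_sum_inv F_rule one_stab a_orbit b_average.
by rewrite perm_weight1 trimE; apply: (ruleD_inv F_rule aF).
Qed.

Lemma swap_diff_eq0 v :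
  swap_diff Z a b v = 0 -> a |: Z \in F v -> b |: Z \in F v.
Proof.
move=> dv aF; pose n := \sum_X `|v X|.
have shifted_ge0 X : 0 <= (v + [ffun=> n]) X.
  have := ler_norm_sum v X; rewrite ler_norml => /andP[low _].
  by rewrite !ffunE addrC -lerBlDl sub0r.
rewrite -(rule_shift F_rule v n); apply: swap_diff_eq0_ge0 => //.
  by rewrite raddfD /= dv swap_diff_cst // addr0.
by rewrite (rule_shift F_rule).
Qed.

End SwapInvariance.

(** * Scoring functions for adjacent committees *)

Section PartialSums.
Local Open Scope ring_scope.
Variables (R : realDomainType) (n : nat) (delta : 'I_n -> R).

Definition partial_sum (j : nat) : R := \sum_(i < n | (i < j)%N) delta i.

Lemma partial_sum0 : partial_sum 0 = 0.
Proof. by rewrite /partial_sum big1. Qed.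

Lemma partial_sumS (i : 'I_n) : delta i = partial_sum i.+1 - partial_sum i.
Proof.
rewrite /partial_sum [X in X - _](bigD1 i) //=.
rewrite [X in _ + X - _](eq_bigl (fun l : 'I_n => (l < i)%N)) ?addrK // => l.
by rewrite ltnS -val_eqE /=; lia.
Qed.

Hypothesis delta_ge0 : forall i, 0 <= delta i.

Lemma partial_sum_homo : {homo partial_sum : i j / (i <= j)%N >-> i <= j}.
Proof.
move=> i j ij; rewrite /partial_sum.
rewrite [leRHS](bigID (fun l : 'I_n => (l < i)%N)) /=.
rewrite [X in _ <= X + _](eq_bigl (fun l : 'I_n => (l < i)%N)) => [|l].
  by rewrite lerDl sumr_ge0.
by apply/andP/idP => [[]|li] //; split=> //; apply: leq_trans li ij.
Qed.

Lemma partial_sum_increases : \sum_i delta i = 1 ->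
  exists i : 'I_n, partial_sum i < partial_sum i.+1.
Proof.
move=> sum1; have [i di] : exists i, 0 < delta i.
  apply: contrapT => none; have /eqP := sum1.
  rewrite big1 ?[0 == 1]eq_sym ?oner_eq0 // => i _.
  apply/le_anti; rewrite delta_ge0 andbT leNgt; apply/negP => di.
  by apply: none; exists i.
by exists i; rewrite -subr_gt0 -partial_sumS.
Qed.

End PartialSums.

Section LocalScoring.
Local Open Scope ring_scope.
Variables (C : finType) (k : nat) (F : weight C -> {set {set C}}).
Hypothesis F_rule : weight_rule k F.
Implicit Types (v w : weight C) (W X : {set C}).

Section SwapCone.
Variables (Z : {set C}) (a b : C).
Hypotheses (aZ : a \notin Z) (bZ : b \notin Z).
Variable v : weight C.
Hypotheses (aF : a |: Z \in F v) (bF : b |: Z \notin F v).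

Let ab : a != b. Proof. by apply: contraNneq bF => <-. Qed.

Definition swap_cone (d : {ffun 'I_#|Z|.+1 -> int}) : Prop :=
  exists2 w, swap_diff Z a b w = d & a |: Z \in F w.

Lemma swap_cone_closed : add_closed swap_cone.
Proof.
split.
  by exists 0; rewrite ?raddf0 // (rule_zero F_rule) // (rule_card F_rule aF).
move=> _ _ [w <- aw] [w' <- aw']; exists (w + w'); first by rewrite raddfD.
exact: (ruleD F_rule).
Qed.

(* By independence of losers, [a |: Z] wins when a ballot drops [b]. *)
Lemma swap_cone_single l : swap_cone (single l).
Proof.
have [Y YZ Yl] := exists_subset_ord l.
have bY : b \notin Y := contraNN (fintype.subsetP YZ b) bZ.
have capY x : x \notin Z -> (x |: Y) :&: Z = Y.
  move=> xZ; rewrite setIUl (setIidPl YZ) disjoint_setI0 ?set0U //.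
  by rewrite disjoints1.
exists (single (a |: Y) - single (a |: (b |: Y))); last first.
  apply: (rule_losers F_rule); first exact: rule_card aF.
  - by apply/set0Pn; exists a; rewrite !inE eqxx.
  - by rewrite setUS ?subsetUr.
  - apply/setP => x; rewrite !inE; case: (eqVneq x b) => [->|//].
    by rewrite eq_sym (negbTE ab) (negbTE bZ).
rewrite raddfB /= !swap_diff_single /swap_sign !inE !eqxx /= !orbT.
rewrite subrr mulr0z subr0 [b == a]eq_sym (negbTE ab) (negbTE bY) mulr1z.
by rewrite capY // Yl inord_val.
Qed.

(* If the all-ones vector were in the opposite cone, then so would be
   [swap_diff Z a b v], and [swap_diff_eq0] would make [b |: Z] win at [v]. *)
Lemma swap_cone_proper : ~ swap_cone (- [ffun=> 1]).
Proof.
move=> cone_neg; pose d := swap_diff Z a b v.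
have [n cone_sub] := ones_order_unit swap_cone_closed swap_cone_single d.
have [w dw aw] : swap_cone (- d).
  have cone_negMn := add_closedMn n swap_cone_closed cone_neg.
  have := swap_cone_closed.2 _ _ cone_negMn cone_sub.
  by rewrite mulNrn addrA addNr add0r.
case/negP: bF; apply: (ruleD_inv F_rule aF aw).
apply: (swap_diff_eq0 F_rule aZ bZ ab); last exact: (ruleD F_rule).
by rewrite raddfD /= dw subrr.
Qed.

End SwapCone.

Variable R : realType.

Definition optimal_within (s : nat -> R) (t : nat) :=
  forall v W X, W \in F v -> #|X| = #|W| -> (#|W :\: X| <= t)%N ->
    score s X v <= score s W v.

Lemma optimal_within1 s (Z : {set C}) a b :
  a \notin Z -> b \notin Z -> a != b -> #|Z|.+1 = k ->
  (forall v, a |: Z \in F v -> score s (b |: Z) v <= score s (a |: Z) v) ->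
  optimal_within s 1.
Proof.
move=> aZ bZ ab Zk loc v W X WF eXW.
rewrite leq_eqVlt ltnS leqn0 => /orP[/eqP d1|]; last first.
  by rewrite cards_eq0 setD_eq0 => /(eq_card_subsetP (esym eXW)) ->.
have [Z' [a' [b' [aZ' bZ' WE XE]]]] := adjacent_sets (esym eXW) d1.
have a'b' : a' != b'.
  by apply: contra_eqN d1 => /eqP e; rewrite WE XE e setDv cards0.
have Zk' : #|Z'| = #|Z|.
  by apply/eq_add_S; rewrite Zk -(rule_card F_rule WF) WE cardsU1 aZ'.
have [tau [ta tb _ tZ]] := exists_perm_flag a'b' aZ' bZ' (sub0set Z')
  ab aZ bZ (sub0set Z) erefl Zk'.
have tW : tau @: W = a |: Z by rewrite WE imsetU1 ta tZ.
have tX : tau @: X = b |: Z by rewrite XE imsetU1 tb tZ.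
rewrite -(score_perm_weight s tau X) -(score_perm_weight s tau W) tW tX.
by apply: loc; rewrite -tW (rule_perm F_rule).
Qed.

Theorem exists_local_scoring v W : #|W| = k -> W \notin F v ->
  exists s : nat -> R, [/\ s 0%N = 0, {homo s : i j / (i <= j)%N >-> i <= j},
    exists2 j, (j < k)%N & s j < s j.+1 & optimal_within s 1].
Proof.
move=> Wk WF; have [W' W'F] := set0Pn _ (rule_neq0 F_rule v).
have eWW' : #|W'| = #|W| by rewrite Wk (rule_card F_rule W'F).
have [Z [a [b [aZ bZ aF bF]]]] := exchange_boundary eWW' W'F WF.
have ab : a != b by apply: contraNneq bF => <-.
have Zk : #|Z|.+1 = k by rewrite -(rule_card F_rule aF) cardsU1 aZ.
have [delta [delta_ge0 sum1 delta_pos]] := positive_functional_ffun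
  (swap_cone_closed b aF) (swap_cone_single aZ bZ aF bF) R
  (swap_cone_proper aZ bZ aF bF).
exists (partial_sum delta); split.
- exact: partial_sum0.
- exact: partial_sum_homo.
- have [i si] := partial_sum_increases delta_ge0 sum1.
  by exists i => //; rewrite -Zk.
- apply: (optimal_within1 aZ bZ ab Zk) => w aw; rewrite -subr_ge0.
  rewrite (score_swap aZ bZ w (partial_sumS delta)).
  by apply: delta_pos; exists w.
Qed.

End LocalScoring.

(** * From local to global optimality: linear scoring functions *)

Section LinearScoring.
Local Open Scope ring_scope.
Variables (R : realType) (C : finType) (s : nat -> R) (k : nat).
Hypothesis s_linear : forall i, (i <= k)%N -> s i = s 1%N *+ i.
Implicit Types (v : weight C) (W X Y : {set C}).

Definition candidate_score v (x : C) : R :=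
  linext (fun Y => s 1%N *+ (x \in Y)) v.

Lemma score_linear v W :
  #|W| = k -> score s W v = \sum_(x in W) candidate_score v x.
Proof.
move=> Wk; rewrite exchange_big; apply: eq_bigr => Y _ /=.
rewrite -mulrz_suml sumrMnr sum_mem [W :&: Y]setIC [s #|_|]s_linear //.
by rewrite -Wk subset_leq_card ?subsetIr.
Qed.

Variable F : weight C -> {set {set C}}.
Hypotheses (F_rule : weight_rule k F) (F_local : optimal_within F s 1).

Lemma optimal_linear v W X :
  W \in F v -> #|X| = #|W| -> score s X v <= score s W v.
Proof.
move=> WF eXW; have Wk := rule_card F_rule WF.
have exchange_le a b : a \in W :\: X -> b \in X :\: W ->
    candidate_score v b <= candidate_score v a.
  move=> /setDP[aW _] /setDP[_ bW].
  have := F_local WF (card_exchange aW bW) (card_exchangeD W a b).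
  rewrite !score_linear ?card_exchange //.
  rewrite big_setU1 ?inE ?(negbTE bW) ?andbF //=.
  by rewrite [leRHS](big_setD1 a) //= lerD2r.
rewrite !score_linear ?eXW // (big_setID W) [leRHS](big_setID X) /=.
rewrite [X :&: W]setIC lerD2l.
have [tau tauE] := imset_perm_transitive (cardsD_sym (esym eXW)).
rewrite -tauE big_imset /=; last by move=> x y _ _; apply: perm_inj.
by apply: ler_sum => a aWX; apply: exchange_le; rewrite // -tauE imset_f.
Qed.

End LinearScoring.

(** * From local to global optimality: nonlinear scoring functions *)

Section ThresholdBallots.
Local Open Scope ring_scope.
Variables (R : realType) (C : finType) (s : nat -> R) (j : nat).
Hypothesis s_linear_below : forall i, (i < j)%N -> s i = s 1%N *+ i.
Implicit Types (D V : {set C}) (g : {set C} -> nat).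

Definition nonlinearity : R := s j - s 1%N *+ j.

(* [s] is linear below [j], so only supersets of [D] score on this weight. *)
Definition superset_ballot D : weight C :=
  (single D - \sum_(x in D) single [set x]) *~ sgz nonlinearity.

Lemma score_superset_ballot D V : #|D| = j ->
  score s V (superset_ballot D) = `|nonlinearity| *+ (D \subset V).
Proof.
move=> Dj; rewrite raddfMz raddfB /= (raddf_sum (score s V)) /= score_single.
have -> : \sum_(x in D) score s V (single [set x]) =
    s 1%N *+ #|D :&: V| + s 0%N *+ #|D :\: V|.
  rewrite (big_setID V) -!sumr_const.
  congr (_ + _); apply: eq_bigr => x; rewrite score_single.
    by case/setIP=> _ xV; rewrite (setIidPl _) ?sub1set // cards1.
  by case/setDP=> _ xV; rewrite disjoint_setI0 ?disjoints1 // cards0.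
have [/setIidPl DV|DV] := boolP (D \subset V).
  have -> : D :\: V = set0 by apply/eqP; rewrite setD_eq0; apply/setIidPl.
  by rewrite DV Dj cards0 mulr0n addr0 mulr1n -mulrzl -sgrEz -normrEsg.
have cDV : (#|D :&: V| < j)%N.
  rewrite -Dj; apply: proper_card; rewrite properEneq subsetIl andbT.
  by apply: contraNneq DV => <-; rewrite subsetIr.
have s0 : s 0%N = 0 by rewrite s_linear_below ?mulr0n ?(leq_ltn_trans _ cDV).
by rewrite (s_linear_below cDV) s0 mul0rn addr0 subrr mul0rz.
Qed.

Lemma perm_superset_ballot (tau : {perm C}) D :
  perm_weight tau (superset_ballot D) = superset_ballot (tau @: D).
Proof.
rewrite raddfMz raddfB /= (raddf_sum (perm_weight tau)) /= perm_weight_single.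
congr ((_ - _) *~ _).
rewrite big_imset /=; last by move=> x y _ _; apply: perm_inj.
by apply: eq_bigr => x _; rewrite perm_weight_single imset_set1.
Qed.

Definition subset_weight g : weight C :=
  \sum_(D : {set C} | #|D| == j) superset_ballot D *+ g D.

Definition subset_sum g V : nat :=
  \sum_(D : {set C} | (D \subset V) && (#|D| == j)) g D.

Lemma score_subset_weight g V :
  score s V (subset_weight g) = `|nonlinearity| *+ subset_sum g V.
Proof.
rewrite raddf_sum -sumrMnr [RHS]big_mkcondl; apply: eq_bigr => D /eqP Dj /=.
rewrite raddfMn /= score_superset_ballot //.
by case: ifP; rewrite ?mulr1n ?mul0rn.
Qed.

Lemma perm_subset_weight (tau : {perm C}) g : (forall D, g (tau @: D) = g D) ->
  perm_weight tau (subset_weight g) = subset_weight g.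
Proof.
move=> g_inv; rewrite raddf_sum [RHS](reindex_inj (@imset_perm_inj _ tau)) /=.
apply: eq_big => D; rewrite ?card_imset_perm // => _.
by rewrite raddfMn /= perm_superset_ballot g_inv.
Qed.

End ThresholdBallots.

Section TwoCommittees.
Local Open Scope ring_scope.
Variables (R : realType) (C : finType) (s : nat -> R) (j : nat).
Hypothesis s_linear_below : forall i, (i < j)%N -> s i = s 1%N *+ i.
Variables W X : {set C}.
Hypothesis eWX : #|W| = #|X|.
Implicit Types (D V : {set C}).

Definition overlap (x : C) : nat := (x \in W) + (x \in X).
Definition total_overlap V : nat := \sum_(x in V) overlap x.

Lemma total_overlap_between V : between W X V ->
  total_overlap V = (#|V| + #|W :&: X|)%N.
Proof.
case/andP=> lo up; rewrite /total_overlap big_split /= !sum_mem.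
rewrite -cardsUI -setIUr.
by rewrite (setIidPl up) setIACA setIid (setIidPr lo).
Qed.

Lemma overlap_increases V : #|V| = #|W| -> ~~ between W X V ->
  exists x y, [/\ y \in V, x \notin V &
    (total_overlap V < total_overlap (x |: (V :\ y)))%N].
Proof.
move=> eVW nb; suff [x [y [yV xV oxy]]] :
    exists x y, [/\ y \in V, x \notin V & (overlap y < overlap x)%N].
  exists x, y; split=> //; rewrite /total_overlap (big_setD1 y) //=.
  by rewrite big_setU1 ?inE ?(negbTE xV) ?andbF //= ltn_add2r.
have [up|/fintype.subsetPn[y yV]] := boolP (V \subset W :|: X).
  move: nb; rewrite /between up andbT => /fintype.subsetPn[x].
  rewrite inE => /andP[xW xX] xV.
  have : ~~ (V \subset W :&: X).
    apply: contraNN xV => lo; suff -> : V = W by [].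
    by apply/(eq_card_subsetP eVW)/(subset_trans lo)/subsetIl.
  case/fintype.subsetPn=> y yV; rewrite inE => yWX; exists x, y; split=> //.
  by rewrite /overlap xW xX; case: (y \in W) yWX; case: (y \in X).
rewrite inE negb_or => /andP[yW yX].
have : ~~ (W \subset V).
  by apply: contraNN yW => /(eq_card_subsetP (esym eVW)) ->.
case/fintype.subsetPn=> x xW xV; exists x, y; split=> //.
by rewrite /overlap (negbTE yW) (negbTE yX) xW.
Qed.

Definition centre_weight : weight C :=
  subset_weight s j (fun D => \sum_(x in D) overlap x)%N.

Lemma score_centre_weight V : (0 < j)%N ->
  score s V centre_weight =
  (`|nonlinearity s j| *+ 'C(#|V|.-1, j.-1)) *+ total_overlap V.
Proof.
move=> j_gt0; rewrite score_subset_weight // -mulrnA; congr (_ *+ _).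
rewrite /subset_sum (exchange_big_dep (mem V)) /=; last first.
  by move=> D x /andP[DV _]; apply: fintype.subsetP.
rewrite /total_overlap big_distrr; apply: eq_bigr => x xV /=.
rewrite sum_nat_const -(card_draws_mem _ xV) prednK //; congr (_ * _)%N.
by apply: eq_card => D; rewrite !inE andbA.
Qed.

Definition mixed_weight : weight C :=
  subset_weight s j (fun D => ~~ (D \subset W) && ~~ (D \subset X)).

Lemma score_mixed_weight_eq0 V : V = W \/ V = X -> score s V mixed_weight = 0.
Proof.
move=> VWX; rewrite score_subset_weight // [subset_sum _ _ _]big1 // => D.
by case/andP; case: VWX => -> ->; rewrite ?andbF.
Qed.

Lemma score_mixed_weight_gt0 V : nonlinearity s j != 0 -> (2 <= j <= #|W|)%N ->
  #|V| = #|W| -> V != W -> V != X -> 0 < score s V mixed_weight.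
Proof.
move=> nonlin /andP[j2 jW] eVW VW VX.
have [x [_ [/setDP[xV xW] _]]] := exists_exchange eVW VW.
have [y [_ [/setDP[yV yX] _]]] := exists_exchange (etrans eVW eWX) VX.
have [||D [xyD DV Dj]] := @exists_subset_card _ [set x; y] V j.
- by rewrite subUset !sub1set xV.
- by rewrite eVW jW andbT (leq_trans _ j2) // cards2; case: (_ != _).
have [xD yD] : x \in D /\ y \in D.
  by move: xyD; rewrite subUset !sub1set => /andP.
have DW : ~~ (D \subset W) by apply: contraNN xW => /fintype.subsetP ->.
have DX : ~~ (D \subset X) by apply: contraNN yX => /fintype.subsetP ->.
rewrite score_subset_weight // pmulrn_lgt0 ?normr_gt0 //.
by rewrite /subset_sum (bigD1 D) ?DV ?Dj ?eqxx //= DW DX.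
Qed.

Lemma exchanging_perm : exists tau : {perm C}, [/\ tau @: W = X,
  perm_weight tau centre_weight = centre_weight &
  perm_weight tau mixed_weight = mixed_weight].
Proof.
have disj : uniq (enum (W :\: X) ++ enum (X :\: W)).
  rewrite cat_uniq !enum_uniq andbT; apply/hasPn => x; rewrite !mem_enum !inE.
  by case: (x \in W); case: (x \in X).
have [|h h_inv [hWX hfix]] := exists_involution disj.
  by rewrite -!cardE cardsD_sym.
pose tau := perm (inv_inj h_inv).
have tauWX : tau @: (W :\: X) = X :\: W.
  by apply: imset_map_enum; rewrite -hWX; apply: eq_map => x; rewrite permE.
have tauK : cancel (fun D => tau @: D) (fun D => tau @: D).
  move=> D; rewrite -imset_permM.
  suff -> : (tau * tau = 1)%g by apply: imset_perm1.
  by apply/permP => x; rewrite permM !permE.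
have tauI : tau @: (W :&: X) = W :&: X.
  rewrite -[RHS]imset_id; apply: eq_in_imset => x.
  rewrite inE permE => /andP[xW xX].
  by apply: hfix; rewrite mem_cat !mem_enum !inE xW xX.
have tauW : tau @: W = X by rewrite -(setID W X) imsetU tauI tauWX setIC setID.
have tauX : tau @: X = W by rewrite -tauW tauK.
exists tau; split=> //; apply: perm_subset_weight => D.
  rewrite big_imset /=; last by move=> x y _ _; apply: perm_inj.
  apply: eq_bigr => x _; rewrite /overlap -{1}tauX -{2}tauW !mem_imset_perm.
  by rewrite addnC.
have subE V : (tau @: D \subset V) = (D \subset tau @: V).
  by apply/idP/idP => /(imsetS tau); rewrite tauK.
by rewrite !subE tauW tauX andbC.
Qed.

End TwoCommittees.

Section NonlinearStep.
Local Open Scope ring_scope.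
Variables (R : realType) (C : finType) (s : nat -> R) (k j : nat).
Hypotheses (s0 : s 0%N = 0) (nonlin : nonlinearity s j != 0)
  (s_linear_below : forall i, (i < j)%N -> s i = s 1%N *+ i)
  (j_le_k : (j <= k)%N).
Variable F : weight C -> {set {set C}}.
Hypothesis F_rule : weight_rule k F.
Variable t : nat.
Hypotheses (t_gt0 : (0 < t)%N) (F_optimal : optimal_within F s t).
Variables W X : {set C}.
Hypotheses (Wk : #|W| = k) (Xk : #|X| = k) (dWX : #|W :\: X| = t.+1).
Implicit Types (u v : weight C) (V M : {set C}).

Let centre := centre_weight s j W X.
Let mixed := mixed_weight s j W X.

Let eWX : #|W| = #|X|. Proof. by rewrite Wk Xk. Qed.

Let j_ge2 : (2 <= j)%N.
Proof.
move: nonlin; rewrite /nonlinearity; case: (j) => [|[|//]].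
  by rewrite s0 mulr0n subrr eqxx.
by rewrite mulr1n subrr eqxx.
Qed.

Let score_centre_between V :
  #|V| = k -> between W X V -> score s V centre = score s W centre.
Proof.
move=> Vk bV; rewrite /centre !score_centre_weight // ?(ltnW j_ge2) // Vk Wk.
by rewrite !total_overlap_between ?Vk ?Wk // /between subsetIl subsetUl.
Qed.

Let between_X : between W X X.
Proof. by rewrite /between subsetIr subsetUr. Qed.

Let mixed_W : score s W mixed = 0.
Proof. by apply: score_mixed_weight_eq0 => //; left. Qed.

Let mixed_X : score s X mixed = 0.
Proof. by apply: score_mixed_weight_eq0 => //; right. Qed.

Definition strictly_between V :=
  [&& #|V| == k, between W X V, V != W & V != X].

Lemma between_cases V : #|V| = k -> between W X V ->
  [\/ V = W, V = X | strictly_between V].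
Proof.
move=> Vk bV; have [|VW] := eqVneq V W; first by constructor 1.
have [|VX] := eqVneq V X; first by constructor 2.
by constructor 3; rewrite /strictly_between Vk eqxx bV VW.
Qed.

Lemma strictly_betweenP V : strictly_between V ->
  [/\ #|V| = k, (#|V :\: W| <= t)%N, (#|V :\: X| <= t)%N & (#|W :\: V| <= t)%N].
Proof.
case/and4P=> /eqP Vk bV VW VX.
have le_t d : (d < #|W :\: X|)%N -> (d <= t)%N by rewrite dWX ltnS.
split=> //; apply: le_t.
- by rewrite (cardsD_sym eWX) between_cardDl ?Vk ?Xk // betweenC.
- by rewrite between_cardDl ?Vk ?Wk.
- by rewrite between_cardDr ?Vk ?Xk.
Qed.

Lemma score_mixed_strictly_between V :
  strictly_between V -> 0 < score s V mixed.
Proof.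
case/and4P=> /eqP Vk _ VW VX.
by apply: score_mixed_weight_gt0; rewrite ?j_ge2 ?Wk ?Vk.
Qed.

Lemma winners_eventually_between u : exists n0, forall n, (n0 <= n)%N ->
  forall V, V \in F (u + centre *+ n) -> between W X V.
Proof.
pose bound := \sum_(V : {set C}) `|score s V u|.
pose gain : R := `|nonlinearity s j| *+ 'C(k.-1, j.-1).
have gain_gt0 : 0 < gain.
  by rewrite pmulrn_lgt0 ?normr_gt0 // bin_gt0 -!subn1 leq_sub2r.
have [n0 far] := eventually_lt_mulrn (bound + bound) gain_gt0.
exists n0 => n /far{}far V VF; apply: contraT => nb.
have Vk := rule_card F_rule VF.
have [x [y [yV xV better]]] := overlap_increases (etrans Vk (esym Wk)) nb.
pose V' := x |: V :\ y.
have dVV' := leq_trans (card_exchangeD V y x) t_gt0.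
have := F_optimal VF (card_exchange yV xV) dVV'.
rewrite !raddfD !raddfMn /= !score_centre_weight // ?(ltnW j_ge2) //.
rewrite card_exchange // Vk -/gain -/V' => exchange_le.
have gain_le : gain *+ n <=
    gain *+ total_overlap W X V' *+ n - gain *+ total_overlap W X V *+ n.
  rewrite -mulrnBl ler_wMn2r // -mulrnBr; last exact: ltnW.
  by rewrite -[leLHS]mulr1n ler_wpMn2l ?(ltW gain_gt0) // subn_gt0.
have /ler_normlP[low _] := ler_norm_sum (score s ^~ u) V'.
have /ler_normlP[_ up] := ler_norm_sum (score s ^~ u) V.
by rewrite -/bound in low up; lra.
Qed.

(* For large [n], only [W] and [X] win here: [centre] penalises the committees
   that are not between them, and [- mixed] those strictly between. *)
Lemma pair_elected h : exists n0, forall n, (n0 <= n)%N ->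
  let v := centre *+ n - mixed *+ h.+1 in W \in F v /\ X \in F v.
Proof.
have [n0 loc] := winners_eventually_between (- (mixed *+ h.+1)).
exists n0 => n /loc{}loc; rewrite addrC /=; set u := _ + _ in loc *.
have XW : (X \in F u) = (W \in F u).
  have [tau [tW tcentre tmixed]] := exchanging_perm s j eWX.
  rewrite -{1}tW (rule_perm_fixed F_rule) // /u raddfD raddfN !raddfMn /=.
  by rewrite tcentre tmixed.
rewrite XW; suff WF : W \in F u by [].
have [V VF] := set0Pn _ (rule_neq0 F_rule u).
have [bV Vk] := (loc _ VF, rule_card F_rule VF).
have [<- //|eVX|Vb] := between_cases Vk bV; first by rewrite -XW -eVX.
have [_ dVW _ _] := strictly_betweenP Vb.
have := F_optimal VF (etrans Wk (esym Vk)) dVW.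
rewrite !raddfD !raddfN !raddfMn /= (score_centre_between Vk bV) lerD2r.
rewrite mixed_W oppr0 mul0rn mulNrn oppr_ge0 leNgt pmulrn_lgt0 //.
by rewrite score_mixed_strictly_between.
Qed.

Lemma strictly_between_overtaking v :
  W \in F v -> score s W v < score s X v -> exists u h, [/\ W \in F u,
    exists2 M, strictly_between M &
      score s W u < score s M (u + mixed *+ h.+1) &
    forall M, strictly_between M ->
      score s M (u + mixed *+ h.+1) < score s X u].
Proof.
move=> WF gap; pose bound := \sum_(V : {set C}) `|score s V mixed|.
have [n far] := eventually_lt_mulrn bound (etrans (subr_gt0 _ _) gap).
have WFn : W \in F (v *+ n) by apply: (ruleMn F_rule).
have [M0 M0b] : exists M, strictly_between M.
  have [||M [eMW bM MW MX]] := @exists_between _ W X; rewrite ?dWX //.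
  by exists M; rewrite /strictly_between eMW Wk eqxx bM MW.
have [|||h [[M Mb over] below]] := @first_overtaking _ _ strictly_between
  (fun M => score s M (v *+ n)) (score s ^~ mixed)
  (score s W (v *+ n)) (score s X (v *+ n)) _ M0b.
- move=> M /strictly_betweenP[Mk _ _ dWM].
  by apply: F_optimal; rewrite ?Mk ?Wk.
- exact: score_mixed_strictly_between.
- move=> M _; rewrite -ltrBrDl.
  have norm_le := ler_norm_sum (score s ^~ mixed) M.
  apply: le_lt_trans (le_trans (ler_norm _) norm_le) _.
  by rewrite !raddfMn /= -mulrnDl far.
exists (v *+ n), h; split=> // [|M' /below].
  by exists M; rewrite // raddfD /= [score s M (mixed *+ _)]raddfMn.
by rewrite raddfD /= [score s _ (mixed *+ _)]raddfMn.
Qed.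

Lemma overtaken_loses v n M : strictly_between M ->
  score s W v < score s M v -> W \notin F (v + centre *+ n).
Proof.
move=> Mb over; apply/negP => WF; have [Mk _ _ dWM] := strictly_betweenP Mb.
have [_ bM _ _] := and4P Mb.
have := F_optimal WF (etrans Mk (esym Wk)) dWM.
rewrite !raddfD !raddfMn /= (score_centre_between Mk bM) lerD2r.
by rewrite leNgt over.
Qed.

Lemma leader_wins v n :
  (forall V, V \in F (v + centre *+ n) -> between W X V) ->
  W \notin F (v + centre *+ n) ->
  (forall M, strictly_between M -> score s M v < score s X v) ->
  X \in F (v + centre *+ n).
Proof.
move=> loc WF below.
have [V VF] := set0Pn _ (rule_neq0 F_rule (v + centre *+ n)).
have [bV Vk] := (loc V VF, rule_card F_rule VF).
have [eVW|<- //|Vb] := between_cases Vk bV; first by rewrite -eVW VF in WF.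
have [_ _ dVX _] := strictly_betweenP Vb.
have := F_optimal VF (etrans Xk (esym Vk)) dVX.
rewrite !raddfD !raddfMn /= (score_centre_between Vk bV).
by rewrite (score_centre_between Xk between_X) lerD2r leNgt below.
Qed.

(* Suppose that [X] outscores [W] although [W] wins. Adding [mixed] to a
   multiple [u] of [v] lets an intermediate committee overtake [W] but not [X],
   so [X] wins and [W] loses. This is unaffected when a weight at which both win
   takes [mixed] out again; so [W] loses at the sum of [u] and such a weight,
   although it wins at both. *)
Theorem optimal_step v : W \in F v -> score s X v <= score s W v.
Proof.
move=> WF; rewrite leNgt; apply/negP => /(strictly_between_overtaking WF).
move=> [u [h [Wu [M Mb over] below]]]; pose v' := u + mixed *+ h.+1.
have score_v' V : score s V mixed = 0 -> score s V v' = score s V u.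
  by move=> mixed0; rewrite raddfD raddfMn /= mixed0 mul0rn addr0.
have [n0 loc] := winners_eventually_between v'.
have [n1 elect1] := pair_elected 0; have [n2 elect2] := pair_elected h.+1.
pose n := (n0 + n1)%N; pose w := v' + centre *+ n.
have Ww : W \notin F w.
  by apply: overtaken_loses Mb _; rewrite (score_v' _ mixed_W).
have Xw : X \in F w.
  apply: leader_wins Ww _ => [|M' M'b]; first exact/loc/leq_addr.
  by rewrite (score_v' _ mixed_X) below.
have [_ X2] := elect2 n2 (leqnn _).
have [|W1 _] := elect1 (n2 + n)%N; first by rewrite /n addnA leq_addl.
case/negP: Ww; apply: (ruleD_inv F_rule Xw X2).
suff -> : w + (centre *+ n2 - mixed *+ h.+2) =
    u + (centre *+ (n2 + n) - mixed *+ 1) by exact: (ruleD F_rule).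
rewrite /w /v' mulr1n (mulrnDr _ n2 n) [mixed *+ h.+2]mulrSr opprD -!addrA.
congr (u + _).
by rewrite [X in _ + X]addrA addrCA addNKr [_ *+ n + _]addrC -addrA.
Qed.

End NonlinearStep.

Section GlobalScoring.
Local Open Scope ring_scope.
Variables (R : realType) (C : finType) (k : nat).
Variable F : weight C -> {set {set C}}.
Hypothesis F_rule : weight_rule k F.
Implicit Types (v : weight C) (D V W X : {set C}) (s : nat -> R).

Lemma nonlinear_threshold s : ~ (forall i, (i <= k)%N -> s i = s 1%N *+ i) ->
  exists j, [/\ (j <= k)%N, nonlinearity s j != 0 &
    forall i, (i < j)%N -> s i = s 1%N *+ i].
Proof.
move=> nonlin; pose nonlin_at i := (i <= k)%N && (s i != s 1%N *+ i).
have ex_j : exists i, nonlin_at i.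
  apply: contrapT => none; apply: nonlin => i ik.
  apply/eqP; apply: contraT => ne.
  by case: none; exists i; rewrite /nonlin_at ik.
case: (ex_minnP ex_j) => j /andP[jk jn] jmin; exists j.
rewrite /nonlinearity subr_eq0; split=> // i ij.
apply/eqP; apply: contraT => ne.
have := jmin i; rewrite /nonlin_at ne (leq_trans (ltnW ij) jk) leqNgt ij.
by move=> /(_ isT).
Qed.

Lemma optimal_global s v W X : s 0%N = 0 -> optimal_within F s 1 ->
  W \in F v -> #|X| = #|W| -> score s X v <= score s W v.
Proof.
move=> s0 local WF eXW.
have [lin|] := pselect (forall i, (i <= k)%N -> s i = s 1%N *+ i).
  exact: (optimal_linear lin F_rule local).
case/nonlinear_threshold=> j [jk nonlin below].
suff all t : optimal_within F s t.+1 by apply: (all #|W :\: X|).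
elim: t => // t IH u V Y VF eYV.
rewrite leq_eqVlt ltnS => /orP[/eqP dVY|]; last exact: IH.
have Vk := rule_card F_rule VF; have Yk := etrans eYV Vk.
exact: (optimal_step s0 nonlin below jk F_rule (ltn0Sn t) IH Vk Yk dVY VF).
Qed.

Lemma exists_subset_ballot W V n : #|V| = #|W| -> V != W -> (n < #|W|)%N ->
  exists D, [/\ D \subset W, #|D| = n.+1 & (#|D :&: V| <= n)%N].
Proof.
move=> eVW VW nW; have [_ [x [_ /setDP[xW xV]]]] := exists_exchange eVW VW.
have [||D [xD DW Dn]] := @exists_subset_card _ [set x] W n.+1.
- by rewrite sub1set.
- by rewrite cards1 nW.
exists D; split=> //; rewrite -ltnS -Dn; apply/proper_card/properP; split.
  exact: subsetIl.
by exists x; rewrite ?inE ?(negbTE xV) ?andbF // -sub1set.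
Qed.

(* The sum of the ballots of size [j.+1] inside [W] is maximised by [W] alone;
   continuity lets it break the ties at [v]. *)
Lemma maximiser_wins s j v W :
  {homo s : i j / (i <= j)%N >-> i <= j} -> (j < k)%N -> s j < s j.+1 ->
  (forall v W X, W \in F v -> #|X| = #|W| -> score s X v <= score s W v) ->
  #|W| = k -> (forall X, #|X| = k -> score s X v <= score s W v) -> W \in F v.
Proof.
move=> s_homo jk s_lt opt Wk Wmax.
pose tie_breaker :=
  \sum_(D : {set C} | (D \subset W) && (#|D| == j.+1)) single D.
have [n sub] := rule_continuous F_rule v tie_breaker.
have [V VF] := set0Pn _ (rule_neq0 F_rule (v *+ n + tie_breaker)).
have eVW : #|V| = #|W| by rewrite Wk (rule_card F_rule VF).
suff -> : W = V by apply: (fintype.subsetP sub).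
apply/eqP; rewrite eq_sym; apply: contraT => VW.
have := opt _ _ _ VF (esym eVW); rewrite leNgt => /negP; case.
rewrite !raddfD !raddfMn /=; apply: ler_ltD.
  by rewrite lerMn2r Wmax ?orbT ?eVW.
have [|D [DW Dj DV]] := exists_subset_ballot eVW VW (n := j).
  by rewrite Wk.
rewrite !raddf_sum (bigD1 D) ?DW ?Dj ?eqxx //=.
rewrite [ltRHS](bigD1 D) ?DW ?Dj ?eqxx //=.
apply: ltr_leD; rewrite ?score_single.
  by rewrite (setIidPl DW) Dj; apply: le_lt_trans (s_homo _ _ DV) s_lt.
apply: ler_sum => E /andP[/andP[EW _] _]; rewrite !score_single s_homo //.
by rewrite subset_leq_card // (setIidPl EW) subsetIl.
Qed.

Theorem weight_rule_scoring : exists s : nat -> R,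
  [/\ s 0%N = 0, {homo s : i j / (i <= j)%N >-> i <= j} &
    forall v, F v = argmax k (fun W => score s W v)].
Proof.
have [[v0 [W0 [W0k W0F]]]|all_win] :=
    pselect (exists v W, #|W| = k /\ W \notin F v).
  have [s [s0 s_homo [j jk s_lt] local]] :=
    exists_local_scoring F_rule R W0k W0F.
  exists s; split=> // v; apply/setP => W.
  apply/idP/argmaxP => [WF|[Wk Wmax]].
    have Wk := rule_card F_rule WF; split=> // X Xk.
    by apply: optimal_global => //; rewrite Xk.
  by apply: (maximiser_wins s_homo jk s_lt) => // *; apply: optimal_global.
exists (fun=> 0); split=> // v; apply/setP => W.
apply/idP/argmaxP => [WF|[Wk _]].
  split=> [|X _]; first exact: rule_card WF.
  by rewrite /score /linext !big1 // => Y _; rewrite mul0rz.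
by apply: contraT => WF; case: all_win; exists v, W.
Qed.

End GlobalScoring.

(** * Profiles and their ballot counts *)

Section Tally.
Local Open Scope ring_scope.
Variable m : nat.
Implicit Types (A B : ballots m) (v : weight 'I_m) (W X : {set 'I_m}).

Definition ballot A (i : nat) : {set 'I_m} := odflt set0 (A.[? i])%fmap.

Lemma fnd_ballot A i : i \in domf A -> (A.[? i])%fmap = Some (ballot A i).
Proof. by move=> iA; rewrite /ballot in_fnd. Qed.

Lemma ballot_fsval A (x : domf A) : ballot A (fsval x) = A x.
Proof.
by rewrite /ballot (in_fnd (fsvalP x)) /=; congr (A _); apply: val_inj.
Qed.

Definition tally A : weight 'I_m := \sum_(i <- domf A) single (ballot A i).

Lemma tallyE A X : tally A X = (count_mem X [seq ballot A i | i <- domf A])%:Z.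
Proof. by rewrite -sum_singleE big_map. Qed.

Lemma tally_ge0 A X : 0 <= tally A X.
Proof. by rewrite tallyE. Qed.

Lemma is_profileE A : is_profile A = (tally A != 0) && (tally A set0 == 0).
Proof.
rewrite /is_profile; congr (_ && _).
  apply/idP/idP; last by apply: contraNneq => A0; rewrite /tally A0 big_nil.
  case/fset0Pn => i iA; apply/eqP => /ffunP/(_ (ballot A i))/eqP.
  by rewrite tallyE ffunE eqz_nat eqn0Ngt -has_count has_pred1 map_f.
rewrite tallyE eqz_nat -leqn0 leqNgt -has_count has_pred1.
apply/forallP/negP => [nonempty /mapP[i iA e]|no x].
  by have := nonempty [` iA]%fset; rewrite -ballot_fsval /= -e eqxx.
apply/eqP => e; apply/no/mapP.
by exists (fsval x); rewrite ?ballot_fsval ?fsvalP.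
Qed.

Lemma thiele_scoreE (R : realType) (s : nat -> R) A W :
  thiele_score s A W = score s W (tally A).
Proof.
rewrite raddf_sum big_seq_fsetE; apply: eq_bigr => x _ /=.
by rewrite score_single ballot_fsval.
Qed.

Lemma tally_sum A (s : seq nat) : uniq s -> s =i domf A ->
  tally A = \sum_(i <- s) single (ballot A i).
Proof.
move=> us sA; apply: perm_big.
by apply: uniq_perm; rewrite ?fset_uniq // => i; rewrite sA.
Qed.

Lemma tally_setf A i X :
  i \notin domf A -> tally (A.[i <- X])%fmap = single X + tally A.
Proof.
move=> iA; rewrite (@tally_sum _ (i :: domf A)).
- rewrite big_cons /ballot fnd_set eqxx; congr (_ + _).
  apply: eq_big_seq => l lA.
  by rewrite /ballot fnd_set; case: eqVneq lA iA => // -> ->.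
- by rewrite /= iA fset_uniq.
- by move=> l; rewrite mem_setf.
Qed.

Lemma is_profile_setf A i X :
  i \notin domf A -> X != set0 -> tally A set0 = 0 ->
  is_profile (A.[i <- X])%fmap.
Proof.
move=> iA X0 A0; rewrite is_profileE tally_setf // !ffunE A0 addr0.
rewrite [set0 == _]eq_sym (negbTE X0) eqxx andbT.
apply/eqP => /ffunP/(_ X)/eqP.
by rewrite !ffunE eqxx gt_eqF // ltr_pwDl // tally_ge0.
Qed.

Lemma disjoint_profP A B :
  reflect (forall i, i \in domf A -> i \notin domf B) (disjoint_prof A B).
Proof.
apply: (iffP eqP) => [AB i iA|AB].
  by apply/negP => iB; have := in_fset0 i; rewrite -AB inE iA iB.
by apply/fsetP => i; rewrite inE in_fset0; apply/negP => /andP[/AB/negP].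
Qed.

Lemma disjoint_prof_sym A B : disjoint_prof A B = disjoint_prof B A.
Proof. by rewrite /disjoint_prof fsetIC. Qed.

Lemma tally_catf A B :
  disjoint_prof A B -> tally (catf A B) = tally A + tally B.
Proof.
move/disjoint_profP => AB; have notA i : i \in domf B -> i \notin domf A.
  by move=> iB; apply/negP => /AB; rewrite iB.
rewrite (@tally_sum _ (enum_fset (domf A) ++ enum_fset (domf B))).
- rewrite big_cat /tally; congr (_ + _); apply: eq_big_seq => i i_in.
    by rewrite /ballot fnd_cat (negbTE (AB _ i_in)).
  by rewrite /ballot fnd_cat i_in.
- rewrite cat_uniq !fset_uniq andbT; apply/hasPn => i; exact: notA.
- by move=> i; rewrite mem_cat mem_catf.
Qed.

Lemma is_profile_catf A B : disjoint_prof A B -> is_profile A -> is_profile B ->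
  is_profile (catf A B).
Proof.
move=> AB; rewrite !is_profileE tally_catf //.
move=> /andP[A0 /eqP Ae] /andP[_ /eqP Be].
rewrite ffunE Ae Be addr0 eqxx andbT; apply: contraNneq A0 => /ffunP sum0.
apply/eqP/ffunP => X; have /eqP := sum0 X.
by rewrite !ffunE paddr_eq0 ?tally_ge0 // => /andP[/eqP].
Qed.

Lemma tally_relabel (pi : nat -> nat) A B : injective pi -> relabel pi A B ->
  tally B = tally A.
Proof.
move=> pi_inj [dB vB].
rewrite /tally dB big_imfset /=; last by move=> i j _ _ /pi_inj.
by apply: eq_big_seq => i iA; rewrite /ballot vB.
Qed.

Lemma tally_cand_perm (tau : {perm 'I_m}) A :
  tally (cand_perm tau A) = perm_weight tau (tally A).
Proof.
rewrite raddf_sum; apply: eq_big_seq => i iA /=; have iA' : i \in domf A := iA.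
rewrite perm_weight_single /ballot (@in_fnd _ _ (cand_perm tau A) _ iA).
rewrite (in_fnd iA') /= ffunE.
by congr (single (imset _ (mem (A _)))); apply: val_inj.
Qed.

Lemma is_profile_cand_perm (tau : {perm 'I_m}) A :
  is_profile A -> is_profile (cand_perm tau A).
Proof.
rewrite !is_profileE tally_cand_perm !ffunE imset0.
case/andP=> A0 ->; rewrite andbT.
apply: contraNneq A0 => /ffunP A0; apply/eqP/ffunP => X.
by have := A0 (tau @: X); rewrite !ffunE imset_permK.
Qed.

Definition copy_index n A := [seq (j, i) | j <- iota 0 n, i <- domf A].

Lemma copy_index_uniq n A : uniq (copy_index n A).
Proof. by rewrite allpairs_uniq ?iota_uniq ?fset_uniq // => -[? ?] [? ?]. Qed.

Lemma mem_copy_index n A j i :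
  ((j, i) \in copy_index n A) = (j < n)%N && (i \in domf A).
Proof.
apply/allpairsPdep/andP => [[j' [i' [j'n i'A [-> ->]]]]|[jn iA]].
  by rewrite mem_iota in j'n.
by exists j, i; rewrite mem_iota.
Qed.

Lemma sum_copy_index n A :
  \sum_(p <- copy_index n A) single (ballot A p.2) = tally A *+ n.
Proof.
by rewrite big_allpairs /= big_const_seq count_predT size_iota iter_addr_0.
Qed.

Lemma tally_copies n A B : copies n A B -> tally B = tally A *+ n.
Proof.
move=> [g [g_inj [gB gA]]]; rewrite -sum_copy_index.
rewrite (@tally_sum _ [seq g p.1 p.2 | p <- copy_index n A]).
- rewrite big_map; apply: eq_big_seq => -[j i].
  by rewrite mem_copy_index => /andP[jn iA] /=; rewrite /ballot gA.
- rewrite map_inj_in_uniq ?copy_index_uniq // => -[j i] [j' i'].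
  rewrite !mem_copy_index => /andP[jn iA] /andP[j'n i'A] /=.
  by case/(g_inj _ _ _ _ jn j'n iA i'A) => -> ->.
- move=> x; apply/mapP/idP => [[[j i]]|/gB[j [i [jn [iA ->]]]]].
    by rewrite mem_copy_index => /andP[jn iA] ->; apply/gB; exists j, i.
  by exists (j, i); rewrite // mem_copy_index jn.
Qed.

Lemma is_profile_copies n A B : (0 < n)%N -> copies n A B ->
  is_profile A -> is_profile B.
Proof.
move=> n_gt0 /tally_copies tB.
rewrite !is_profileE tB ffunMnE => /andP[A0 /eqP->].
rewrite mul0rn eqxx andbT; apply: contraNneq A0 => /ffunP A0.
apply/eqP/ffunP => X; have /eqP := A0 X; rewrite !ffunMnE !ffunE mulrn_eq0.
by case/orP=> /eqP //; case: (n) n_gt0.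
Qed.

Lemma copies_tally n A B : tally B = tally A *+ n -> copies n A B.
Proof.
set s := copy_index n A; have memS j i := mem_copy_index n A j i.
rewrite -sum_copy_index -/s /tally -[LHS](big_map (ballot B) xpredT single).
rewrite -(big_map (fun p => ballot A p.2) xpredT single).
case/esym/sum_single_perm/perm_map_matching => t tB eAB.
have st : size s = size t.
  by rewrite -(size_map (fun p => ballot A p.2)) eAB size_map.
have t_uniq : uniq t by rewrite (perm_uniq tB) fset_uniq.
have t_mem x : (x \in t) = (x \in domf B) := perm_mem tB x.
pose g j i := nth 0%N t (index (j, i) s).
have g_lt j i : (j < n)%N -> i \in domf A -> (index (j, i) s < size t)%N.
  by move=> jn iA; rewrite -st index_mem memS jn.
exists g; split; [|split].
- move=> j j' i i' jn j'n iA i'A /eqP; rewrite nth_uniq ?g_lt // => /eqP e.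
  have := nth_index (0, 0)%N (_ : (j, i) \in s).
  rewrite memS jn iA e => /(_ isT).
  by rewrite nth_index ?memS ?j'n // => -[-> ->].
- move=> x; rewrite -t_mem.
  split=> [xt|[j [i [jn [iA ->]]]]]; last by rewrite mem_nth ?g_lt.
  have : nth (0, 0)%N s (index x t) \in s by rewrite mem_nth // st index_mem.
  case def_ji: (nth _ s _) => [j i]; rewrite memS => /andP[jn iA].
  exists j, i; do 2![split=> //].
  rewrite /g -def_ji index_uniq ?copy_index_uniq // ?st ?index_mem //.
  by rewrite nth_index.
- move=> j i jn iA; rewrite !fnd_ballot // -?t_mem ?mem_nth ?g_lt //.
  congr Some.
  rewrite -(nth_map _ set0) ?g_lt // -eAB (nth_map (0, 0)%N) ?st ?g_lt //.
  by rewrite nth_index // memS jn.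
Qed.

Definition realisable v :=
  forall o, exists A, tally A = v /\ forall i, i \in domf A -> (o <= i)%N.

Lemma domf_bounded A : exists o, forall i, i \in domf A -> (i < o)%N.
Proof.
exists (\max_(i <- domf A) i).+1 => i iA.
by rewrite ltnS (@leq_bigmax_seq _ _ xpredT id).
Qed.

Lemma realisable_closed : add_closed realisable.
Proof.
split=> [o|v w v_real w_real o].
  by exists [fmap]%fmap; split; rewrite // /tally big_nil.
have [A [<- Ao]] := v_real o; have [o' A_lt] := domf_bounded A.
have [B [<- Bo]] := w_real (maxn o o'); exists (catf A B); split.
  apply/tally_catf/disjoint_profP => i /A_lt io'; apply/negP => /Bo.
  by rewrite geq_max [(o' <= _)%N]leqNgt io' andbF.
move=> i; rewrite mem_catf => /orP[/Ao//|/Bo].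
by rewrite geq_max => /andP[].
Qed.

Lemma realisable_single X : realisable (single X).
Proof.
move=> o; exists ([fmap].[o <- X])%fmap; split.
  by rewrite tally_setf // /tally big_nil addr0.
by move=> i; rewrite mem_setf !inE => /eqP->.
Qed.

Lemma exists_disjoint_tally A v : (forall X, 0 <= v X) ->
  exists2 B, tally B = v & disjoint_prof A B.
Proof.
move=> v0; have [o A_lt] := domf_bounded A.
have [B [Bv Bo]] := add_closed_ge0 realisable_closed realisable_single v0 o.
exists B => //; apply/disjoint_profP => i /A_lt io.
by apply/negP => /Bo; rewrite leqNgt io.
Qed.

End Tally.

Section Anonymity.
Variables (m : nat) (f : ballots m -> {set {set 'I_m}}).
Hypothesis f_anonymous : anonymous f.
Implicit Types A B : ballots m.

Lemma anonymous_disjoint A B : is_profile A -> disjoint_prof A B ->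
  tally A = tally B -> f A = f B.
Proof.
move=> A_prof /disjoint_profP AB.
rewrite /tally -[LHS](big_map (ballot A) xpredT single).
rewrite -[RHS](big_map (ballot B) xpredT single).
case/sum_single_perm/perm_map_matching => t tB eAB.
have t_mem x : (x \in t) = (x \in domf B) := perm_mem tB x.
have [||h h_inv [hA _]] := @exists_involution _ (domf A) t.
- rewrite cat_uniq fset_uniq (perm_uniq tB) fset_uniq andbT; apply/hasPn => i.
  by rewrite t_mem => iB; apply/negP => /AB; rewrite iB.
- by rewrite -(size_map (ballot A)) eAB size_map.
apply/esym/(f_anonymous (inv_bij h_inv) A_prof); split.
  apply/fsetP => i; rewrite -t_mem -hA.
  by apply/mapP/imfsetP => -[l lA ->]; exists l.
move=> i iA; have hi : h i \in domf B by rewrite -t_mem -hA map_f.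
rewrite !fnd_ballot //; congr Some; move: eAB; rewrite -hA -map_comp.
by move=> /eq_in_map/(_ i iA) ->.
Qed.

Lemma anonymous_tally A B : is_profile A -> tally A = tally B -> f A = f B.
Proof.
move=> A_prof AB.
have B_prof : is_profile B by rewrite is_profileE -AB -is_profileE.
have [D tD ABD] := exists_disjoint_tally (catf A B) (tally_ge0 A).
have [AD BD] : disjoint_prof A D /\ disjoint_prof B D.
  split; apply/disjoint_profP => i iAB; apply: (disjoint_profP _ _ ABD);
    by rewrite mem_catf iAB ?orbT.
rewrite (anonymous_disjoint A_prof AD) ?tD //.
by rewrite -(anonymous_disjoint B_prof BD) ?tD.
Qed.

End Anonymity.

(** * Extension of a voting rule to ballot weights *)

Section Extension.
Local Open Scope ring_scope.
Variables (m k : nat) (f : ballots m -> {set {set 'I_m}}).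
Hypotheses (m_gt0 : (0 < m)%N) (f_ABC : is_ABC_rule k f)
  (f_anonymous : anonymous f) (f_neutral : neutral f)
  (f_consistent : consistent f) (f_continuous : continuous f)
  (f_indep : indep_losers f).
Implicit Types (A B : ballots m) (v w : weight 'I_m) (W X : {set 'I_m}).

Lemma eq_tally A B : is_profile A -> is_profile B ->
  (forall X, X != set0 -> tally A X = tally B X) -> tally A = tally B.
Proof.
rewrite !is_profileE => /andP[_ /eqP A0] /andP[_ /eqP B0] AB; apply/ffunP => X.
by have [->|/AB] := eqVneq X set0; rewrite ?A0.
Qed.

Definition represents v A := is_profile A /\
  exists n : int, forall X, X != set0 -> tally A X = v X + n.

Lemma exists_represents v A : exists2 B, represents v B & disjoint_prof A B.
Proof.
pose n := \sum_X `|v X| + 1.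
have pos X : 0 < v X + n.
  have := ler_norm_sum v X; rewrite ler_norml => /andP[low _].
  by rewrite /n addrA ltr_pwDr // -lerBlDr sub0r.
have [X|B tB AB] :=
    @exists_disjoint_tally _ A [ffun X => if X == set0 then 0 else v X + n].
  by rewrite ffunE; case: ifP => // _; apply: ltW.
exists B => //; split; last by exists n => X X0; rewrite tB ffunE (negbTE X0).
rewrite is_profileE tB ffunE eqxx andbT; apply/eqP => /ffunP/(_ setT).
have setT0 : [set: 'I_m] != set0.
  by apply/set0Pn; exists (Ordinal m_gt0); rewrite inE.
by rewrite !ffunE (negbTE setT0) => e; have := pos setT; rewrite e ltxx.
Qed.

Lemma represents_tally A : is_profile A -> represents (tally A) A.
Proof. by split=> //; exists 0 => X _; rewrite addr0. Qed.

Lemma represents_shift v (n : int) A :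
  represents (v + [ffun=> n]) A -> represents v A.
Proof.
case=> A_prof [p tA]; split=> //; exists (n + p) => X X0.
by rewrite tA // !ffunE addrA.
Qed.

Lemma represents_catf v w A B :
  disjoint_prof A B -> represents v A -> represents w B ->
  represents (v + w) (catf A B).
Proof.
move=> AB [A_prof [n tA]] [B_prof [p tB]]; split; first exact: is_profile_catf.
by exists (n + p) => X X0; rewrite tally_catf // !ffunE tA // tB // addrACA.
Qed.

Lemma represents_cand_perm (tau : {perm 'I_m}) v A :
  represents v A -> represents (perm_weight tau v) (cand_perm tau A).
Proof.
move=> [A_prof [n tA]]; split; first exact: is_profile_cand_perm.
by exists n => X X0; rewrite tally_cand_perm !ffunE tA // imset_eq0.
Qed.

Lemma represents_copies n v A B : (0 < n)%N -> copies n A B ->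
  represents v A -> represents (v *+ n) B.
Proof.
move=> n_gt0 AB [A_prof [p tA]].
split; first exact: is_profile_copies AB A_prof.
by exists (p *+ n) => X X0; rewrite (tally_copies AB) !ffunMnE tA // mulrnDl.
Qed.

Lemma uniform_winners U W : represents 0 U -> #|W| = k -> W \in f U.
Proof.
move=> U_rep; have [U_prof [n tU]] := U_rep; have [fU0 fUk] := f_ABC U_prof.
have [W0 W0U] := set0Pn _ fU0.
rewrite -(fUk _ W0U) => /esym/imset_perm_transitive[tau <-].
have [tauU_prof _] := represents_cand_perm tau U_rep.
have <- : f (cand_perm tau U) = f U.
  apply: (anonymous_tally f_anonymous) => //; apply: eq_tally => // X X0.
  by rewrite tally_cand_perm ffunE !tU ?imset_eq0 // !ffunE.
by rewrite f_neutral //; apply: imset_f.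
Qed.

Lemma uniform_profile A (n : int) : 0 < n ->
  exists U, [/\ is_profile U, disjoint_prof A U &
    forall X, X != set0 -> tally U X = n].
Proof.
move=> n_gt0; have [X|U tU AU] :=
    @exists_disjoint_tally _ A [ffun X => n *+ (X != set0)].
  by rewrite ffunE mulrn_wge0 ?ltW.
exists U; split=> // [|X X0]; last by rewrite tU ffunE X0.
rewrite is_profileE tU ffunE eqxx andbT; apply/eqP => /ffunP/(_ setT)/eqP.
rewrite !ffunE mulrb; case: ifP => [_|/negbFE/eqP/setP/(_ (Ordinal m_gt0))].
  by rewrite gt_eqF.
by rewrite !inE.
Qed.

(* All committees win at a uniform profile, so adding one changes nothing. *)
Lemma padding A (n : int) : is_profile A -> 0 < n -> exists A',
  [/\ is_profile A', f A' = f A &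
    forall X, X != set0 -> tally A' X = tally A X + n].
Proof.
move=> A_prof n_gt0; have [U [U_prof AU tU]] := uniform_profile A n_gt0.
have U_rep : represents 0 U.
  by split=> //; exists n => X /tU ->; rewrite ffunE add0r.
have [fA0 fAk] := f_ABC A_prof.
have fAU : f A :&: f U = f A.
  apply/setIidPl/fintype.subsetP => W WA.
  exact: (uniform_winners U_rep (fAk W WA)).
exists (catf A U); split; first exact: is_profile_catf.
  by rewrite f_consistent ?fAU.
by move=> X X0; rewrite tally_catf // ffunE tU.
Qed.

Lemma represents_unique v A B : represents v A -> represents v B -> f A = f B.
Proof.
move=> [A_prof [n tA]] [B_prof [p tB]]; pose q := `|n| + `|p| + 1.
have [qn qp] : 0 < q - n /\ 0 < q - p by split; rewrite /q; lia.
have [A' [A'_prof <- tA']] := padding A_prof qn.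
have [B' [B'_prof <- tB']] := padding B_prof qp.
apply: (anonymous_tally f_anonymous) => //; apply: eq_tally => // X X0.
by rewrite tA' // tA // tB' // tB // -(addrA _ n) -(addrA _ p) !subrKC.
Qed.

Definition extend_rule v := f (classical_sets.xget [fmap]%fmap (represents v)).

Lemma extend_ruleE v A : represents v A -> extend_rule v = f A.
Proof.
move=> vA; apply: (@represents_unique v) => //.
by apply: classical_sets.xgetPex; exists A.
Qed.

Lemma extend_rule_losers W X X' : #|W| = k -> X' != set0 -> X' \subset X ->
  W :&: X' = W :&: X -> W \in extend_rule (single X' - single X).
Proof.
move=> Wk X'0 X'X WX.
have X0 : X != set0 by apply: contraNneq X'0 => X0; rewrite -subset0 -X0.
have [Y|A tA _] := @exists_disjoint_tally m [fmap]%fmap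
    [ffun Y => (Y \notin [set set0; X])%:Z].
  by rewrite ffunE.
have tA0 : tally A set0 = 0 by rewrite tA ffunE set21.
have [i iA] : exists i, i \notin domf A.
  have [i A_lt] := domf_bounded A; exists i.
  by apply: contraTN isT => /A_lt; rewrite ltnn.
have X_uniform : represents 0 (A.[i <- X])%fmap.
  split; first exact: is_profile_setf.
  exists 1 => Y Y0; rewrite tally_setf // !ffunE tA ffunE !inE (negbTE Y0).
  by case: eqVneq.
have X'_rep : represents (single X' - single X) (A.[i <- X'])%fmap.
  split; first exact: is_profile_setf.
  exists 1 => Y Y0; rewrite tally_setf // !ffunE tA ffunE !inE (negbTE Y0).
  by rewrite -addrA; case: (Y == X).
rewrite (extend_ruleE X'_rep).
apply: (f_indep X_uniform.1 X'_rep.1) (uniform_winners X_uniform Wk).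
  by apply/fsetP => l; rewrite !mem_setf.
move=> l _ Y Y'; rewrite !fnd_set; case: ifP => _; first by move=> [<-] [<-].
by move=> -> [->].
Qed.

Lemma extend_rule_shift v (n : int) :
  extend_rule (v + [ffun=> n]) = extend_rule v.
Proof.
have [A vA _] := exists_represents (v + [ffun=> n]) [fmap]%fmap.
by rewrite (extend_ruleE vA) (extend_ruleE (represents_shift vA)).
Qed.

Lemma extend_rule_neutral (tau : {perm 'I_m}) v W :
  (tau @: W \in extend_rule (perm_weight tau v)) = (W \in extend_rule v).
Proof.
have [A vA _] := exists_represents v [fmap]%fmap.
rewrite (extend_ruleE vA) (extend_ruleE (represents_cand_perm tau vA)).
rewrite (f_neutral _ vA.1).
by rewrite mem_imset //; apply: imset_perm_inj.
Qed.

Lemma extend_rule_consistent v w W :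
  W \in extend_rule v -> W \in extend_rule w ->
  extend_rule (v + w) = extend_rule v :&: extend_rule w.
Proof.
have [A vA _] := exists_represents v [fmap]%fmap.
have [B wB AB] := exists_represents w A.
rewrite (extend_ruleE (represents_catf AB vA wB)).
rewrite (extend_ruleE vA) (extend_ruleE wB) => WA WB.
by apply: (f_consistent vA.1 wB.1 AB); apply/set0Pn; exists W; rewrite inE WA.
Qed.

Lemma extend_rule_continuous v w :
  exists n, extend_rule (v *+ n + w) \subset extend_rule v.
Proof.
have [A vA _] := exists_represents v [fmap]%fmap.
have [B wB _] := exists_represents w [fmap]%fmap.
have [n [n_gt0 sub]] := f_continuous vA.1 wB.1; exists n.
have [X|D tD BD] := @exists_disjoint_tally _ B (tally A *+ n).
  by rewrite ffunMnE mulrn_wge0 ?tally_ge0.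
rewrite disjoint_prof_sym in BD; have AD := copies_tally tD.
have D_rep := represents_copies n_gt0 AD vA.
by rewrite (extend_ruleE (represents_catf BD D_rep wB)) (extend_ruleE vA) sub.
Qed.

Theorem extend_is_weight_rule : weight_rule k extend_rule.
Proof.
split.
- move=> v; have [A vA _] := exists_represents v [fmap]%fmap.
  by rewrite (extend_ruleE vA); case: (f_ABC vA.1).
- move=> v W; have [A vA _] := exists_represents v [fmap]%fmap.
  by rewrite (extend_ruleE vA); case: (f_ABC vA.1) => _; apply.
- exact: extend_rule_shift.
- exact: extend_rule_neutral.
- exact: extend_rule_consistent.
- exact: extend_rule_continuous.
- exact: extend_rule_losers.
Qed.

Lemma extend_rule_tally A : is_profile A -> extend_rule (tally A) = f A.
Proof. by move=> A_prof; apply/extend_ruleE/represents_tally. Qed.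

End Extension.

(** * Thiele rules satisfy the axioms *)

Section ThieleAxioms.
Local Open Scope ring_scope.
Variables (R : realType) (m k : nat) (f : ballots m -> {set {set 'I_m}}).
Variable s : nat -> R.
Hypothesis f_thiele : forall A, is_profile A ->
  f A = argmax k (fun W => score s W (tally A)).

Lemma thiele_anonymous : anonymous f.
Proof.
move=> pi A B pi_bij A_prof AB.
have tB := tally_relabel (bij_inj pi_bij) AB.
by rewrite !f_thiele // ?tB // is_profileE tB -is_profileE.
Qed.

Lemma thiele_neutral : neutral f.
Proof.
move=> tau A A_prof; rewrite !f_thiele ?is_profile_cand_perm // tally_cand_perm.
apply/setP => W; rewrite -(imset_permKV tau W).
rewrite [RHS]mem_imset; last exact: imset_perm_inj.
move: (_ @: W) => {}W.
apply/argmaxP/argmaxP; rewrite card_imset_perm => -[Wk max].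
  split=> // V Vk; rewrite -(score_perm_weight s tau V).
  by rewrite -(score_perm_weight s tau W) max // card_imset_perm.
split=> // V Vk; rewrite -(imset_permKV tau V) !score_perm_weight max //.
by rewrite card_imset_perm.
Qed.

Lemma thiele_consistent : consistent f.
Proof.
move=> A B A_prof B_prof AB.
rewrite !f_thiele ?is_profile_catf // tally_catf //.
case/set0Pn=> W0; rewrite inE => /andP[/argmaxP[W0k maxA] /argmaxP[_ maxB]].
apply/setP => W; rewrite [RHS]inE; apply/argmaxP/andP.
  move=> [Wk maxAB]; have := maxAB _ W0k; rewrite !raddfD /= => le0.
  have leA := maxA _ Wk; have leB := maxB _ Wk.
  split; apply/argmaxP; split=> // V Vk.
    by have := maxA _ Vk; lra.
  by have := maxB _ Vk; lra.
move=> [/argmaxP[Wk maxWA] /argmaxP[_ maxWB]]; split=> // V Vk.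
by rewrite !raddfD lerD ?maxWA ?maxWB.
Qed.

Lemma thiele_continuous : continuous f.
Proof.
move=> A B A_prof B_prof.
pose a W := score s W (tally A); pose b W := score s W (tally B).
have beaten (p : {set 'I_m} * {set 'I_m}) : exists n0, forall n, (n0 <= n)%N ->
    a p.1 < a p.2 -> b p.1 - b p.2 < (a p.2 - a p.1) *+ n.
  have [lt|ge] := ltP (a p.1) (a p.2); last by exists 0%N.
  have gap_gt0 : 0 < a p.2 - a p.1 by rewrite subr_gt0.
  have [n0 far] := eventually_lt_mulrn (b p.1 - b p.2) gap_gt0.
  by exists n0 => n /far.
have [n_of far] := fin_all_exists beaten.
pose n := (\max_p n_of p).+1; exists n; split=> // D AD DB.
rewrite !f_thiele ?is_profile_catf ?(is_profile_copies _ AD) //.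
rewrite tally_catf // (tally_copies AD).
apply/fintype.subsetP => W /argmaxP[Wk max]; apply/argmaxP; split=> // V Vk.
rewrite leNgt; apply/negP => WV; have := max V Vk; rewrite !raddfD !raddfMn /=.
have := far (W, V) n (leqW (leq_bigmax _)) WV; rewrite /a /b /= mulrnBl.
lra.
Qed.

Lemma thiele_indep_losers : is_thiele_scoring k s -> indep_losers f.
Proof.
case=> _ s_homo A B W A_prof B_prof dAB sub.
rewrite !f_thiele // => /argmaxP[Wk max].
have ballotB i : i \in domf A ->
    ballot B i \subset ballot A i /\ W :&: ballot B i = W :&: ballot A i.
  by move=> iA; apply: (sub i iA); rewrite fnd_ballot // -dAB.
have scoreE D V :
    score s V (tally D) = \sum_(i <- domf D) s #|ballot D i :&: V|.
  by rewrite raddf_sum; apply: eq_bigr => i _ /=; rewrite score_single.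
apply/argmaxP; split=> // V Vk.
have -> : score s W (tally B) = score s W (tally A).
  rewrite !scoreE -dAB; apply: eq_big_seq => i iA.
  by have [_ WAB] := ballotB i iA; rewrite setIC WAB setIC.
apply: le_trans (max _ Vk); rewrite !scoreE -dAB big_seq [leRHS]big_seq.
apply: ler_sum => i iA; have [BA _] := ballotB i iA; apply: s_homo.
by rewrite subset_leq_card ?setSI //= -Vk subset_leq_card // subsetIr.
Qed.

End ThieleAxioms.

Theorem theorem1 (R : realType) (m k : nat) (f : ballots m -> {set {set 'I_m}}) :
  (2 <= m)%N -> (1 <= k)%N -> (k <= m - 1)%N -> is_ABC_rule k f ->
  (is_thiele_rule R k f <->
   [/\ anonymous f, neutral f, consistent f, continuous f & indep_losers f]).
Proof.
move=> m_ge2 _ _ f_ABC; have m_gt0 := ltnW m_ge2.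
have argmax_thiele s A :
    argmax k (thiele_score s A) = argmax k (fun W => score s W (tally A)).
  exact/eq_argmax/thiele_scoreE.
split=> [[s [s_scoring f_thiele]]|[f_anon f_neut f_cons f_cont f_ind]].
  have fE A : is_profile A -> f A = argmax k (fun W => score s W (tally A)).
    by move/f_thiele ->; apply: argmax_thiele.
  split.
  - exact: thiele_anonymous fE.
  - exact: thiele_neutral fE.
  - exact: thiele_consistent fE.
  - exact: thiele_continuous fE.
  - exact: thiele_indep_losers fE s_scoring.
have F_rule :=
  extend_is_weight_rule m_gt0 f_ABC f_anon f_neut f_cons f_cont f_ind.
have [s [s0 s_homo FE]] := weight_rule_scoring R F_rule.
exists s; split=> [|A A_prof].
  by split=> // i j /andP[ij _]; apply: s_homo.
rewrite -[RHS]/(argmax k (thiele_score s A)) argmax_thiele -FE.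
by rewrite (extend_rule_tally m_gt0 f_ABC).
Qed.
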